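(* Let $E$ and $F$ be directed graphs. If $E$ and $F$ are conjugate, then $\mathcal{G}_E$ and $\mathcal{G}_F$ are isomorphic as topological groupoids, and hence there is a $*$-isomorphism from $C^*(E)$ to $C^*(F)$ which maps $\mathcal{D}(E)$ onto $\mathcal{D}(F)$.
   Context: $\mathbb{N}$ contains $0$. A (directed) graph $E=(E^0,E^1,r,s)$ consists of countable sets $E^0$, $E^1$ and maps $r,s:E^1\to E^0$. A path of length $n\ge 1$ is $\mu=\mu_1\cdots\mu_n$ with $\mu_i\in E^1$, $r(\mu_i)=s(\mu_{i+1})$; $s(\mu)=s(\mu_1)$, $r(\mu)=r(\mu_n)$, $|\mu|=n$. Vertices are paths of length $0$ with $r(v)=s(v)=v$. $E^*$ is the set of all finite paths, $vE^1=\{e\in E^1:s(e)=v\}$, $E^0_{\rm reg}=\{v: vE^1\text{ is finite and nonempty}\}$, $E^0_{\rm sing}=E^0\setminus E^0_{\rm reg}$. $C^*(E)$ is the universal $C^*$-algebra generated by mutually orthogonal projections $p_v$ ($v\in E^0$) and partial isometries $s_e$ ($e\in E^1$) with $s_e^*s_e=p_{r(e)}$, $s_es_e^*\le p_{s(e)}$, and $p_v=\sum_{e\in vE^1}s_es_e^*$ for $v\in E^0_{\rm reg}$. For $\mu=\mu_1\cdots\mu_n$, $s_\mu=s_{\mu_1}\cdots s_{\mu_n}$, and $s_v=p_v$. $\mathcal{D}(E)=\overline{\operatorname{span}}\{s_\mu s_\mu^*:\mu\in E^*\}$. $E^\infty$ is the set of infinite paths. $\partial E=E^\infty\cup\{\mu\in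 E^*:r(\mu)\in E^0_{\rm sing}\}$. For $\mu\in E^*$, $Z(\mu)=\{\mu x: x\in\partial E, s(x)=r(\mu)\}$, and for finite $K\subseteq r(\mu)E^1$, $Z(\mu\setminus K)=Z(\mu)\setminus\bigcup_{e\in K}Z(\mu e)$; these sets form a basis of compact open sets for a locally compact Hausdorff topology on $\partial E$. $\partial E^{\ge n}=\{x\in\partial E:|x|\ge n\}$. The shift $\sigma_E:\partial E^{\ge1}\to\partial E$ deletes the first edge ($\sigma_E(e)=r(e)$ for $e\in\partial E\cap E^1$); $\sigma_E^n$ is its $n$-fold composition, defined on $\partial E^{\ge n}$, and $\sigma_E^0=\mathrm{id}$. The graph groupoid is $\mathcal{G}_E=\{(x,m-n,y):x,y\in\partial E,\ m,n\in\mathbb{N},\ \sigma_E^m(x)=\sigma_E^n(y)\}$ with $(x,k,y)(y,l,z)=(x,k+l,z)$, $(x,k,y)^{-1}=(y,-k,x)$. Its topology has as basis the sets $Z(U,m,n,V)=\{(x,m-n,y):x\in U,y\in V,\sigma_E^m(x)=\sigma_E^n(y)\}$, where $U\subseteq\partial E^{\ge m}$, $V\subseteq\partial E^{\ge n}$ are open, $\sigma_E^m|_U$ and $\sigma_E^n|_V$ are injective, and $\sigma_E^m(U)=\sigma_E^n(V)$. $E$ and $F$ are conjugate if there is a homeomorphism $h:\partial E\to\partial F$ such that $h(\partial E^{\ge 1})=\partial F^{\ge 1}$ and $h(\sigma_E(x))=\sigma_F(h(x))$ for all $x\in\partial E^{\ge 1}$.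
   Formalization: In the definition of C*(E), the partial isometries s_e are additionally required to have mutually orthogonal ranges (s_e^* s_f = 0 for e ≠ f), as is standard; without this the claim fails for graphs with vertices emitting infinitely many edges. *)

(* Defs.v *)
From HB Require Import structures.
From mathcomp Require Import all_boot all_order all_algebra.
From mathcomp Require Import complex.
From mathcomp Require Import all_classical all_reals all_analysis.
From mathcomp Require Import zify ring.

Set Implicit Arguments.
Unset Strict Implicit.
Unset Printing Implicit Defensive.

Import Order.TTheory GRing.Theory Num.Theory.
Import numFieldNormedType.Exports.

Local Open Scope classical_set_scope.
Local Open Scope ring_scope.

Record digraph := Digraph {
  vert : countType;
  edge : countType;
  rng : edge -> vert;
  src : edge -> vert }.

Section Paths.
Variable E : digraph.

Definition out (v : vert E) : set (edge E) := [set e | src e = v].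
Definition regular (v : vert E) : Prop := finite_set (out v) /\ out v !=set0.
Definition singular (v : vert E) : Prop := ~ regular v.

Fixpoint chain (v : vert E) (es : seq (edge E)) : bool :=
  if es is e :: es' then (src e == v) && chain (rng e) es' else true.

(* A finite path is its source together with its list of edges, so that the
   paths of length 0 are the vertices. *)
Record fpath := FPath {
  fsrc : vert E;
  fedges : seq (edge E);
  fpathP : chain fsrc fedges }.

Definition flen (mu : fpath) : nat := size (fedges mu).
Definition frng (mu : fpath) : vert E :=
  last (fsrc mu) (map (@rng E) (fedges mu)).

Record ipath := IPath {
  iedge : nat -> edge E;
  ipathP : forall i, rng (iedge i) = src (iedge i.+1) }.

Inductive bpath :=
  | BFin (mu : fpath) of singular (frng mu)
  | BInf of ipath.

Definition bsrc (x : bpath) : vert E :=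
  match x with BFin mu _ => fsrc mu | BInf x => src (iedge x 0) end.

Definition blen_ge (n : nat) : set bpath :=
  [set x | match x with BFin mu _ => (n <= flen mu)%N | BInf _ => True end].

Lemma chain_cat v s t :
  chain v (s ++ t) = chain v s && chain (last v (map (@rng E) s)) t.
Proof. by elim: s v => //= e s IH v; rewrite IH andbA. Qed.

Lemma fcat_subproof (mu nu : fpath) :
  fsrc nu = frng mu -> chain (fsrc mu) (fedges mu ++ fedges nu).
Proof. by move=> h; rewrite chain_cat fpathP -/(frng mu) -h fpathP. Qed.

Definition fcat (mu nu : fpath) (h : fsrc nu = frng mu) : fpath :=
  FPath (fcat_subproof h).

Lemma frng_fcat (mu nu : fpath) (h : fsrc nu = frng mu) :
  frng (fcat h) = frng nu.
Proof. by rewrite {1}/frng /= map_cat last_cat -/(frng mu) -h. Qed.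

Lemma icat_subproof (mu : fpath) (x : ipath) (h : src (iedge x 0) = frng mu) :
  let y i := nth (iedge x (i - flen mu)) (fedges mu) i in
  forall i, rng (y i) = src (y i.+1).
Proof.
case: mu h => v es esP; rewrite /frng /flen /= => h i.
elim: es v esP h i => [|e es IH] v /=; first by move=> _ _ i; rewrite !subn0 !nth_nil ipathP.
move=> /andP[_ esP] h [|i]; last by rewrite !subSS; exact: IH esP h i.
case: es esP h {IH} => [|f es] /=; first by rewrite subnn => _ ->.
by move=> /andP[/eqP-> _].
Qed.

Definition icat (mu : fpath) (x : ipath) (h : src (iedge x 0) = frng mu) : ipath :=
  IPath (icat_subproof h).

Definition bcat (mu : fpath) (x : bpath) : bsrc x = frng mu -> bpath :=
  match x with
  | BFin nu s => fun h => @BFin (fcat h) (eq_ind_r singular s (frng_fcat h))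
  | BInf x => fun h => BInf (icat h)
  end.

Definition Z (mu : fpath) : set bpath :=
  [set y | exists (x : bpath) (h : bsrc x = frng mu), y = bcat h].

Lemma fedge_subproof (e : edge E) : chain (src e) [:: e].
Proof. by rewrite /= eqxx. Qed.
Definition fedge (e : edge E) : fpath := FPath (fedge_subproof e).

Definition Zminus (mu : fpath) (K : set (edge E)) : set bpath :=
  Z mu `\` [set y | exists2 e, K e & exists h : fsrc (fedge e) = frng mu,
                      Z (fcat h) y].

Definition Zbasis : set (set bpath) :=
  [set B | exists mu K, [/\ finite_set K, K `<=` out (frng mu)
                          & B = Zminus mu K]].

Lemma fshift_subproof (mu : fpath) :
  chain (if fedges mu is e :: _ then rng e else fsrc mu) (behead (fedges mu)).
Proof. by case: mu => v [|e es] //= /andP[]. Qed.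

Definition fshift (mu : fpath) : fpath := FPath (fshift_subproof mu).

Lemma frng_fshift (mu : fpath) : frng (fshift mu) = frng mu.
Proof. by case: mu => v [|e es]. Qed.

Definition ishift (x : ipath) : ipath :=
  @IPath (fun i => iedge x i.+1) (fun i => ipathP x i.+1).

(* The shift is only meaningful on [blen_ge 1]; as a total function it fixes
   the boundary paths of length 0, and [iter n shift] is the n-fold shift only
   on [blen_ge n]. Every use below is guarded accordingly. *)
Definition shift (x : bpath) : bpath :=
  match x with
  | BFin mu s => @BFin (fshift mu) (eq_ind_r singular s (frng_fshift mu))
  | BInf x => BInf (ishift x)
  end.

HB.instance Definition _ := gen_eqMixin bpath.
HB.instance Definition _ := gen_choiceMixin bpath.

Definition bprefix (n : nat) (x : bpath) : seq (edge E) :=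
  match x with BFin mu _ => take n (fedges mu) | BInf x => mkseq (iedge x) n end.

Lemma fpath_eq (mu nu : fpath) :
  fsrc mu = fsrc nu -> fedges mu = fedges nu -> mu = nu.
Proof.
case: mu nu => v s p [w t q] /= e1 e2; subst w t.
by congr FPath; exact: Prop_irrelevance.
Qed.

Lemma ipath_eq (x y : ipath) : iedge x =1 iedge y -> x = y.
Proof.
case: x y => f p [g q] /= /funext e; subst g.
by congr IPath; exact: Prop_irrelevance.
Qed.

Lemma BFin_eq mu nu s t : mu = nu -> @BFin mu s = @BFin nu t.
Proof. by move=> e; subst nu; congr BFin; exact: Prop_irrelevance. Qed.

Lemma take_bprefix m n x : (m <= n)%N -> take m (bprefix n x) = bprefix m x.
Proof.
case: x => [mu s|x] mn /=; first by rewrite take_takel.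
by rewrite /mkseq -map_take take_iota (minn_idPl mn).
Qed.

Lemma ZP mu y :
  Z mu y <-> bsrc y = fsrc mu /\ bprefix (flen mu) y = fedges mu.
Proof.
split=> [[x [h ->]]|].
  case: x h => [nu s|x] h /=; first by rewrite take_size_cat.
  split.
    case: mu h => v [|e es] /= p h; first by rewrite h.
    by have /andP[/eqP] := p.
  apply: (@eq_from_nth _ (iedge x 0)); rewrite size_mkseq // => i il.
  by rewrite nth_mkseq //=; apply: set_nth_default.
case: y => [nu s|y] /= [sE pE].
  have c : chain (frng mu) (drop (flen mu) (fedges nu)).
    by have := fpathP nu; rewrite -{1}(cat_take_drop (flen mu) (fedges nu))
      chain_cat pE sE => /andP[].
  have r : frng (FPath c) = frng nu.
    rewrite [RHS]/frng -[in RHS](cat_take_drop (flen mu) (fedges nu)).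
    by rewrite map_cat last_cat pE sE.
  have s' : singular (frng (FPath c)) by rewrite r.
  exists (BFin s'), erefl; apply: BFin_eq; apply: fpath_eq => //=.
  by rewrite -[in RHS]pE cat_take_drop.
have c i : rng (iedge y (i + flen mu)) = src (iedge y (i.+1 + flen mu)).
  by rewrite ipathP.
have h : src (iedge (@IPath (fun i => iedge y (i + flen mu)) c) 0) = frng mu.
  rewrite /= add0n /frng -sE -pE.
  case: (flen mu) => [//|n].
  by rewrite /mkseq -addn1 iotaD !map_cat last_cat /= ipathP addn1.
exists (BInf (@IPath (fun i => iedge y (i + flen mu)) c)), h.
congr BInf; apply: ipath_eq => i /=.
have [il|il] := ltnP i (flen mu).
  by rewrite -pE nth_mkseq.
by rewrite nth_default // subnK.
Qed.

Lemma ZminusP mu K y : K `<=` out (frng mu) ->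
  Zminus mu K y <-> Z mu y /\
    ~ (exists2 e, K e & bprefix (flen mu).+1 y = rcons (fedges mu) e).
Proof.
move=> KO; split=> -[Zy nK]; split=> // -[e Ke he]; apply: nK; exists e => //.
  exists (KO _ Ke); apply/ZP => /=; split; first by case/ZP: Zy.
  by rewrite /flen /= size_cat addn1 he cats1.
case: he => h /ZP /= [_]; rewrite /flen /= size_cat addn1 => ->.
by rewrite cats1.
Qed.

Lemma Zbasis_cover : \bigcup_(B in Zbasis) id B = setT.
Proof.
rewrite predeqE => x; split => // _.
pose mu := @FPath (bsrc x) [::] isT.
exists (Zminus mu set0); first by exists mu, set0; split.
by split; [apply/ZP; split => //; rewrite /flen /=; case: x {mu} => //= nu s; rewrite take0
          |move=> [? []]].
Qed.

Lemma Zminus_sub mu K nu L x : K `<=` out (frng mu) ->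
  (flen mu < flen nu)%N -> Zminus mu K x -> Z nu x ->
  Zminus nu L `<=` Zminus mu K.
Proof.
move=> KO ltl /(ZminusP _ KO)[/ZP[sx px] nK] /ZP[sx' px'] y [/ZP[sy py] _].
have pxy n : (n <= flen nu)%N -> bprefix n x = bprefix n y.
  by move=> nl; rewrite -(take_bprefix x nl) -(take_bprefix y nl) px' py.
apply/ZminusP => //; split.
  by apply/ZP; rewrite -pxy 1?ltnW // px; split=> //; rewrite sy -sx'.
by rewrite -pxy.
Qed.

Lemma Zbasis_join A B x : Zbasis A -> Zbasis B -> id A x -> id B x ->
  exists C, [/\ Zbasis C, id C x & id C `<=` id A `&` id B].
Proof.
move=> [mu [K [fK KO ->]]] [nu [L [fL LO ->]]] /= Ax Bx.
have [ltl|ltl|eql] := ltngtP (flen mu) (flen nu).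
- exists (Zminus nu L); split=> //; first by exists nu, L.
  by rewrite subsetI; split=> //; apply: Zminus_sub KO ltl Ax _; case: Bx.
- exists (Zminus mu K); split=> //; first by exists mu, K.
  by rewrite subsetI; split=> //; apply: Zminus_sub LO ltl Bx _; case: Ax.
have e : mu = nu.
  case: Ax => /ZP[s1 p1] _; case: Bx => /ZP[s2 p2] _.
  by apply: fpath_eq; rewrite -?s1 -?s2 // -p1 -p2 eql.
subst nu; exists (Zminus mu (K `|` L)).
have KLO : K `|` L `<=` out (frng mu) by rewrite subUset.
split.
- by exists mu, (K `|` L); rewrite finite_setU.
- case: Ax Bx => Zx nK [_ nL]; split=> // -[e [Ke|Le] h];
    [apply: nK|apply: nL]; by exists e.
- by move=> y [Zy nKL]; split; split=> // -[e Ke h]; apply: nKL; exists e => //;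
    [left|right].
Qed.

HB.instance Definition _ :=
  isBaseTopological.Build bpath Zbasis_cover Zbasis_join.

End Paths.

Section Shift.
Variable E : digraph.
Implicit Types (x y : bpath E) (mu nu : fpath E) (U V W : set (bpath E)).

Lemma bpath_openP U : open U <->
  forall x, U x -> exists mu K, [/\ finite_set K, K `<=` out (frng mu),
    Zminus mu K x & Zminus mu K `<=` U].
Proof.
split=> [[D DZ <-] x [B DB Bx]|H].
  have [mu [K [fK KO BE]]] := DZ _ DB.
  by exists mu, K; rewrite -BE; split=> // y By; exists B.
exists [set B | Zbasis B /\ B `<=` U]; first by move=> B [].
rewrite predeqE => x; split=> [[B [_ BU] Bx]|/H[mu [K [fK KO Zx ZU]]]].
  exact: BU.
by exists (Zminus mu K) => //; split=> //; exists mu, K.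
Qed.

Lemma Zminus0 mu : Zminus mu set0 = Z mu.
Proof. by rewrite predeqE => x; split=> [[]|Zx] //; split=> // -[? []]. Qed.

Lemma Z_open mu : open (Z mu).
Proof.
by apply/bpath_openP => x Zx; exists mu, set0; rewrite Zminus0; split.
Qed.

Lemma bprefix_shift n x : bprefix n (shift x) = behead (bprefix n.+1 x).
Proof.
case: x => [[v [|e es] p] s|x] //=.
by rewrite /mkseq /= (iotaDl 1 0) -map_comp.
Qed.

Lemma bprefix_iter m n x :
  bprefix n (iter m (@shift E) x) = drop m (bprefix (m + n) x).
Proof.
elim: m n x => [|m IH] n x; first by rewrite drop0.
by rewrite iterSr IH bprefix_shift -drop1 drop_drop addn1 addSn.
Qed.

Lemma bsrc_iter m x : blen_ge m x ->
  bsrc (iter m (@shift E) x) = last (bsrc x) (map (@rng E) (bprefix m x)).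
Proof.
elim: m x => [|m IH] x; first by case: x => [mu s|x] _ //=; rewrite take0.
move=> lx; rewrite iterSr IH; last by case: x lx => [[v [|e es] p] s|x].
rewrite bprefix_shift; case: x lx => [[v [|e es] p] s|x] //= _.
by rewrite ipathP.
Qed.

Lemma blen_geP m x : blen_ge m x <-> size (bprefix m x) = m.
Proof.
case: x => [mu s|x] /=; last by rewrite size_mkseq.
by rewrite size_take_min; split=> [/minn_idPl|<-]; rewrite // geq_minr.
Qed.

Lemma Z_len mu x : Z mu x -> blen_ge (flen mu) x.
Proof. by move=> /ZP[_ px]; apply/blen_geP; rewrite px. Qed.

Lemma bpath_eq x y :
  bsrc x = bsrc y -> (forall n, bprefix n x = bprefix n y) -> x = y.
Proof.
case: x y => [mu s|x] [nu t|y] /= e H.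
- apply: BFin_eq; apply: fpath_eq => //.
  have := H (maxn (flen mu) (flen nu)).
  by rewrite !take_oversize ?leq_maxl ?leq_maxr.
- have := congr1 size (H (flen mu).+1).
  rewrite size_mkseq size_take_min => h.
  by have := geq_minr (flen mu).+1 (flen mu); rewrite h ltnn.
- have := congr1 size (H (flen nu).+1).
  rewrite size_mkseq size_take_min => h.
  by have := geq_minr (flen nu).+1 (flen nu); rewrite -h ltnn.
- congr BInf; apply: ipath_eq => i.
  have := congr1 (fun s => nth (iedge x 0) s i) (H i.+1).
  by rewrite /= !nth_mkseq.
Qed.

Lemma shift_inj mu : {in Z mu &, injective (iter (flen mu) (@shift E))}.
Proof.
move=> x y; rewrite !inE => /ZP[sx px] /ZP[sy py] e.
apply: bpath_eq => [|n]; first by rewrite sx sy.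
have [nm|/ltnW mn] := leqP n (flen mu).
  by rewrite -(take_bprefix x nm) -(take_bprefix y nm) px py.
have := congr1 (bprefix (n - flen mu)) e; rewrite !bprefix_iter subnKC // => d.
rewrite -(cat_take_drop (flen mu) (bprefix n x)) d take_bprefix // px.
by rewrite -py -(take_bprefix y mn) cat_take_drop.
Qed.

Lemma Zminus_fcat mu nu (h : fsrc nu = frng mu) (K : set (edge E)) x :
  K `<=` out (frng nu) ->
  Zminus (fcat h) K x <-> Z mu x /\ Zminus nu K (iter (flen mu) (@shift E) x).
Proof.
move=> KO.
have KO' : K `<=` out (frng (fcat h)) by rewrite frng_fcat.
have szE : flen (fcat h) = (flen mu + flen nu)%N by rewrite /flen size_cat.
have pE n : Z mu x -> bprefix (flen mu + n) x =
    fedges mu ++ bprefix n (iter (flen mu) (@shift E) x).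
  move=> /ZP[_ px]; rewrite bprefix_iter -[X in X ++ _]px.
  by rewrite -(take_bprefix x (leq_addr n (flen mu))) cat_take_drop.
have sE : Z mu x -> bsrc (iter (flen mu) (@shift E) x) = fsrc nu.
  by move=> Zx; rewrite bsrc_iter ?h; [case/ZP: Zx => -> ->|exact: Z_len].
have cat_inj (s t u : seq (edge E)) : s ++ t = s ++ u -> t = u.
  by elim: s => //= a s IH [] /IH.
split=> [/(ZminusP _ KO')[/ZP[sx px] nK]|[Zx /(ZminusP _ KO)[/ZP[sx px] nK]]].
  have Zx : Z mu x.
    apply/ZP; split=> //; rewrite -(take_bprefix x (leq_addr (flen nu) _)) -szE.
    by rewrite px /= take_size_cat.
  split=> //; apply/ZminusP => //; split.
    by apply/ZP; split; [exact: sE|move: px; rewrite szE pE // => /cat_inj].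
  move=> [e Ke he]; apply: nK; exists e => //.
  by rewrite szE -addnS pE // he /= rcons_cat.
apply/ZminusP => //; split.
  by apply/ZP; split; [case/ZP: Zx|rewrite szE pE // px].
move=> [e Ke he]; apply: nK; exists e => //.
by move: he; rewrite szE -addnS pE // /= rcons_cat => /cat_inj.
Qed.

Lemma shift_bcat mu y (h : bsrc y = frng mu) :
  iter (flen mu) (@shift E) (bcat h) = y.
Proof.
have Zc : Z mu (bcat h) by exists y, h.
apply: bpath_eq => [|n].
  by rewrite bsrc_iter ?h; [case/ZP: Zc => -> ->|exact: Z_len].
rewrite bprefix_iter; case: y h {Zc} => [nu s|y] h /=.
  by rewrite take_cat ltnNge leq_addr /= addKn drop_size_cat.
apply: (@eq_from_nth _ (iedge y 0)).
  by rewrite size_drop !size_mkseq addKn.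
move=> i; rewrite size_drop size_mkseq addKn => il.
rewrite nth_drop !nth_mkseq ?ltn_add2l //= nth_default ?leq_addr //.
by rewrite addKn.
Qed.

Lemma fpath_split mu m : (m <= flen mu)%N ->
  exists mu1 mu2 (h : fsrc mu2 = frng mu1), mu = fcat h /\ flen mu1 = m.
Proof.
move=> ml; have c := fpathP mu.
rewrite -(cat_take_drop m (fedges mu)) chain_cat in c.
case/andP: c => c1 c2.
exists (FPath c1), (FPath c2), erefl; split; last exact: size_takel.
by apply: fpath_eq; rewrite //= cat_take_drop.
Qed.

Lemma bpath_split m x : blen_ge m x -> exists2 mu, Z mu x & flen mu = m.
Proof.
move=> lx; have c : chain (bsrc x) (bprefix m x).
  case: x lx => [mu s|x] /= _.
    by have := fpathP mu; rewrite -{1}(cat_take_drop m (fedges mu)) chain_cat => /andP[].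
  elim: m x => //= m IH x; rewrite eqxx /= (iotaDl 1 0) -map_comp ipathP.
  exact: IH (ishift x).
have l : flen (FPath c) = m by apply/blen_geP.
by exists (FPath c) => //; apply/ZP; rewrite l.
Qed.

Lemma nbhs_Zminus m U x : open U -> U x -> blen_ge m x ->
  exists mu K, [/\ finite_set K, K `<=` out (frng mu),
    Zminus mu K x, Zminus mu K `<=` U & (m <= flen mu)%N].
Proof.
move=> /bpath_openP oU /oU[mu [K [fK KO Zx ZU]]] /bpath_split[nu Zn nl].
have [ml|ml] := leqP m (flen mu); first by exists mu, K.
exists nu, set0; split=> //; first by rewrite Zminus0.
  by apply: subset_trans ZU; apply: Zminus_sub KO _ Zx Zn; rewrite nl.
by rewrite nl.
Qed.

Lemma shift_open m U : open U -> U `<=` blen_ge m ->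
  open (iter m (@shift E) @` U).
Proof.
move=> oU Um; apply/bpath_openP => _ [x Ux <-].
have [mu [K [fK KO Zx ZU ml]]] := nbhs_Zminus oU Ux (Um _ Ux).
have [mu1 [mu2 [h [muE m1]]]] := fpath_split ml; subst mu m.
rewrite frng_fcat in KO.
exists mu2, K; split=> //; first by case/(Zminus_fcat h x KO): Zx.
move=> y Zy; have hy : bsrc y = frng mu1 by case: Zy => /ZP[-> _] _.
exists (bcat hy); last exact: shift_bcat.
apply: ZU; apply/Zminus_fcat => //; split; first by exists y, hy.
by rewrite shift_bcat.
Qed.

Lemma shift_continuous m W : open W ->
  open (blen_ge m `&` (iter m (@shift E) @^-1` W)).
Proof.
move=> /bpath_openP oW; apply/bpath_openP => x [lx /oW[mu [K [fK KO Zx ZW]]]].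
have [nu Zn nl] := bpath_split lx; subst m.
have h : fsrc mu = frng nu.
  case: Zx => /ZP[<- _] _; rewrite bsrc_iter //.
  by case/ZP: Zn => -> ->.
exists (fcat h), K; split=> //; first by rewrite frng_fcat.
  by apply/Zminus_fcat.
move=> y /Zminus_fcat[//|Zy Zy']; split; [exact: Z_len|exact: ZW].
Qed.

Definition Zdata U (m n : nat) V : Prop :=
  [/\ open U /\ U `<=` blen_ge m,
      open V /\ V `<=` blen_ge n,
      {in U &, injective (iter m (@shift E))},
      {in V &, injective (iter n (@shift E))}
    & iter m (@shift E) @` U = iter n (@shift E) @` V].

Lemma Zdata_refine U m n V x y :
  open U -> U `<=` blen_ge m -> {in U &, injective (iter m (@shift E))} ->
  open V -> V `<=` blen_ge n -> {in V &, injective (iter n (@shift E))} ->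
  U x -> V y -> iter m (@shift E) x = iter n (@shift E) y ->
  exists U' V', [/\ Zdata U' m n V', U' x, V' y, U' `<=` U & V' `<=` V].
Proof.
move=> oU lU iU oV lV iV Ux Vy exy.
pose W := (iter m (@shift E) @` U) `&` (iter n (@shift E) @` V).
have oW : open W by apply: openI; exact: shift_open.
pose U' := U `&` (blen_ge m `&` (iter m (@shift E) @^-1` W)).
pose V' := V `&` (blen_ge n `&` (iter n (@shift E) @^-1` W)).
have Wx : W (iter m (@shift E) x) by split; [exists x|exists y].
exists U', V'; split; last 2 first.
- by move=> ? [].
- by move=> ? [].
- split.
  + split; first by apply: openI => //; exact: shift_continuous.
    by move=> ? [_ []].
  + split; first by apply: openI => //; exact: shift_continuous.
    by move=> ? [_ []].
  + by move=> a b; rewrite !inE => -[Ua _] [Ub _]; apply: iU; rewrite inE.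
  + by move=> a b; rewrite !inE => -[Ua _] [Ub _]; apply: iV; rewrite inE.
  + rewrite predeqE => z; split=> [[a [Ua [_ Wa]] <-]|[a [Va [_ Wa]] <-]].
      by have [_ [b Vb bE]] := Wa; exists b => //; split=> //; split;
        [exact: lV|rewrite /= bE].
    by have [[b Ub bE] _] := Wa; exists b => //; split=> //; split;
      [exact: lU|rewrite /= bE].
- by split=> //; split=> //; exact: lU.
- by split=> //; split=> //=; [exact: lV|rewrite -exy].
Qed.

End Shift.

Section Groupoid.
Variable E : digraph.

Definition in_gpd (x : bpath E) (k : int) (y : bpath E) : Prop :=
  exists m n : nat, [/\ blen_ge m x, blen_ge n y, k = m%:Z - n%:Z
    & iter m (@shift E) x = iter n (@shift E) y].

Record gpd := Gpd {
  gsrc : bpath E;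
  gdeg : int;
  gtgt : bpath E;
  gpdP : in_gpd gsrc gdeg gtgt }.

Lemma blen_ge_add m n (x : bpath E) :
  blen_ge m x -> blen_ge n (iter m (@shift E) x) -> blen_ge (n + m) x.
Proof.
move=> /blen_geP lm /blen_geP; rewrite bprefix_iter size_drop => h.
apply/blen_geP; rewrite addnC; case: n h => [|n] h; first by rewrite addn0.
have ml : (m <= size (bprefix (m + n.+1) x))%N.
  by rewrite ltnW // -subn_gt0 h.
by rewrite -(subnK ml) h addnC.
Qed.

Lemma blen_ge_iter m n (x : bpath E) :
  blen_ge (n + m) x -> blen_ge n (iter m (@shift E) x).
Proof.
move=> /blen_geP l; apply/blen_geP.
by rewrite bprefix_iter size_drop addnC l addnK.
Qed.

Lemma gmul_subproof (x y z : bpath E) (k l : int) :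
  in_gpd x k y -> in_gpd y l z -> in_gpd x (k + l) z.
Proof.
move=> [m [n [lx ly -> exy]]] [p [q [ly' lz -> eyz]]].
have [np|/ltnW pn] := leqP n p.
  exists ((p - n) + m)%N, q; split=> //.
  - by apply: blen_ge_add => //; rewrite exy; apply: blen_ge_iter; rewrite subnK.
  - by rewrite PoszD -subzn // ; ring.
  - by rewrite iterD exy -iterD subnK.
exists m, ((n - p) + q)%N; split=> //.
- by apply: blen_ge_add => //; rewrite -eyz; apply: blen_ge_iter; rewrite subnK.
- by rewrite PoszD -subzn // ; ring.
- by rewrite iterD -eyz -iterD subnK.
Qed.

Lemma ginv_subproof (x y : bpath E) (k : int) : in_gpd x k y -> in_gpd y (- k) x.
Proof. by move=> [m [n [lx ly -> e]]]; exists n, m; rewrite opprB. Qed.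

Definition composable (g g' : gpd) : Prop := gtgt g = gsrc g'.

Definition gmul (g g' : gpd) (h : composable g g') : gpd :=
  Gpd (gmul_subproof (gpdP g)
        (eq_ind_r (fun y => in_gpd y (gdeg g') (gtgt g')) (gpdP g') h)).

Definition ginv (g : gpd) : gpd := Gpd (ginv_subproof (gpdP g)).

Definition Zgpd (U : set (bpath E)) (m n : nat) (V : set (bpath E)) : set gpd :=
  [set g | [/\ U (gsrc g), V (gtgt g), gdeg g = m%:Z - n%:Z
    & iter m (@shift E) (gsrc g) = iter n (@shift E) (gtgt g)]].

Definition Zgpd_basis : set (set gpd) :=
  [set B | exists U m n V, Zdata U m n V /\ B = Zgpd U m n V].

HB.instance Definition _ := gen_eqMixin gpd.
HB.instance Definition _ := gen_choiceMixin gpd.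

Lemma Zgpd_cover : \bigcup_(B in Zgpd_basis) id B = setT.
Proof.
rewrite predeqE => g; split=> // _.
have [m [n [lx ly kE e]]] := gpdP g.
have [mu Zx mE] := bpath_split lx; have [nu Zy nE] := bpath_split ly; subst m n.
have [U [V [UV Ux Vy _ _]]] := Zdata_refine (@Z_open E mu) (@Z_len E mu)
  (@shift_inj E mu) (@Z_open E nu) (@Z_len E nu) (@shift_inj E nu) Zx Zy e.
by exists (Zgpd U (flen mu) (flen nu) V) => //; exists U, (flen mu), (flen nu), V.
Qed.

Lemma Zgpd_join A B (g : gpd) : Zgpd_basis A -> Zgpd_basis B ->
  id A g -> id B g ->
  exists C, [/\ Zgpd_basis C, id C g & id C `<=` id A `&` id B].
Proof.
move=> [U [m [n [V [UV ->]]]]] [U' [m' [n' [V' [UV' ->]]]]] /=.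
wlog mm' : U m n V U' m' n' V' UV UV' / (m <= m')%N.
  move=> H gA gB; have [/H|/ltnW/H] := leqP m m'; first exact.
  by move=> /(_ _ _ _ _ _ _ UV' UV gB gA)[C [? ? ?]]; exists C; rewrite setIC.
move=> [Ux Vy kE e] [U'x V'y kE' _].
have nn' : (n <= n')%N by lia.
have [[oU lU] [oV lV] iU iV _] := UV; have [[oU' _] [oV' _] _ _ _] := UV'.
have [|||||||||U2 [V2 [UV2 U2x V2y U2U V2V]]] :=
  @Zdata_refine E (U `&` U') m n (V `&` V') (gsrc g) (gtgt g) => //.
- exact: openI.
- by move=> ? [/lU].
- by move=> a b; rewrite !inE => -[Ua _] [Ub _]; apply: iU; rewrite inE.
- exact: openI.
- by move=> ? [/lV].
- by move=> a b; rewrite !inE => -[Ua _] [Ub _]; apply: iV; rewrite inE.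
exists (Zgpd U2 m n V2); split=> //; first by exists U2, m, n, V2.
move=> g' [/U2U[Ua Ua'] /V2V[Vb Vb'] kE2 e2]; split; split=> //.
  by rewrite kE2 -kE.
rewrite -(subnK mm') -(subnK nn') !iterD e2; congr iter; lia.
Qed.

HB.instance Definition _ :=
  isBaseTopological.Build gpd Zgpd_cover Zgpd_join.

End Groupoid.

Definition homeomorphism (X Y : topologicalType) (f : X -> Y) : Prop :=
  continuous f /\ exists g : Y -> X, [/\ continuous g, cancel f g & cancel g f].

Definition conjugate (E F : digraph) : Prop :=
  exists h : bpath E -> bpath F,
    [/\ homeomorphism h,
        h @` blen_ge 1 = blen_ge 1
      & forall x, blen_ge 1 x -> h (shift x) = shift (h x)].

Definition gpd_isomorphism (E F : digraph) (phi : gpd E -> gpd F) : Prop :=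
  [/\ homeomorphism phi,
      forall g g', composable g g' <-> composable (phi g) (phi g'),
      forall g g' (c : composable g g') (c' : composable (phi g) (phi g')),
        phi (gmul c) = gmul c'
    & forall g, phi (ginv g) = ginv (phi g)].

Definition gpd_isomorphic (E F : digraph) : Prop :=
  exists phi : gpd E -> gpd F, gpd_isomorphism phi.

(* A C*-algebra, not necessarily unital, over the complex numbers [R[i]]. The
   norm of a [normedModType R[i]] takes its values in the nonnegative reals,
   seen as elements of [R[i]]. *)
Record cstar_algebra (R : realType) := CStarAlgebra {
  cs_sort :> completeNormedModType R[i];
  cs_mul : cs_sort -> cs_sort -> cs_sort;
  cs_star : cs_sort -> cs_sort;
  cs_mulA : associative cs_mul;
  cs_mulDl : left_distributive cs_mul +%R;
  cs_mulDr : right_distributive cs_mul +%R;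
  cs_scaleAl : forall (c : R[i]) a b, cs_mul (c *: a) b = c *: cs_mul a b;
  cs_scaleAr : forall (c : R[i]) a b, cs_mul a (c *: b) = c *: cs_mul a b;
  cs_starK : involutive cs_star;
  cs_starD : {morph cs_star : a b / a + b};
  cs_starZ : forall (c : R[i]) a, cs_star (c *: a) = c^* *: cs_star a;
  cs_starM : forall a b, cs_star (cs_mul a b) = cs_mul (cs_star b) (cs_star a);
  cs_normM : forall a b, `|cs_mul a b| <= `|a| * `|b|;
  cs_normC : forall a, `|cs_mul (cs_star a) a| = `|a| ^+ 2 }.

Declare Scope cstar_scope.
Delimit Scope cstar_scope with CS.
Local Open Scope cstar_scope.
Notation "a ** b" := (cs_mul a b) (at level 40, left associativity) : cstar_scope.
Notation "a ^#" := (cs_star a) (at level 2, format "a ^#") : cstar_scope.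

Section CStar.
Variable R : realType.

Definition star_hom (A B : cstar_algebra R) (f : A -> B) : Prop :=
  [/\ forall a b, f (a + b) = f a + f b,
      forall (c : R[i]) a, f (c *: a) = c *: f a,
      forall a b, f (a ** b) = f a ** f b
    & forall a, f (a^#) = (f a)^#].

Definition star_iso (A B : cstar_algebra R) (f : A -> B) : Prop :=
  star_hom f /\ bijective f.

Definition projection (A : cstar_algebra R) (p : A) : Prop :=
  p ** p = p /\ p^# = p.

Definition partial_isometry (A : cstar_algebra R) (s : A) : Prop :=
  s ** s^# ** s = s.

(* [q <= p], for projections [q] and [p] *)
Definition proj_le (A : cstar_algebra R) (q p : A) : Prop :=
  p ** q = q /\ q ** p = q.

Definition linear_span (A : cstar_algebra R) (X : set A) : set A :=
  [set a | exists n (c : 'I_n -> R[i]) (x : 'I_n -> A),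
    (forall i, X (x i)) /\ a = \sum_(i < n) c i *: x i].

Definition closed_star_subalgebra (A : cstar_algebra R) (S : set A) : Prop :=
  [/\ closed S, S 0,
      forall a b, S a -> S b -> S (a + b),
      forall (c : R[i]) a, S a -> S (c *: a)
    & (forall a b, S a -> S b -> S (a ** b)) /\ (forall a, S a -> S (a^#))].

Section GraphFamilies.
Variable E : digraph.

(* The ranges of the [s e] are required to be mutually orthogonal, as always in
   the definition of graph C*-algebras. For edges with a common source this
   follows from the other relations when that source is regular, but not when it
   emits infinitely many edges. *)
Definition ck_family (A : cstar_algebra R) (p : vert E -> A) (s : edge E -> A) : Prop :=
  [/\ (forall v, projection (p v)) /\ (forall v w, v <> w -> p v ** p w = 0),
      (forall e, partial_isometry (s e)) /\
        (forall e f, e <> f -> (s e)^# ** s f = 0),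
      forall e, (s e)^# ** s e = p (rng e),
      forall e, proj_le (s e ** (s e)^#) (p (src e))
    & forall v, regular v -> p v = \sum_(e \in out v) s e ** (s e)^#].

(* A together with (p, s) is the universal C*-algebra generated by a
   Cuntz-Krieger E-family; this determines it up to a unique isomorphism. *)
Definition is_graph_algebra (A : cstar_algebra R)
    (p : vert E -> A) (s : edge E -> A) : Prop :=
  [/\ ck_family p s,
      forall S : set A, closed_star_subalgebra S ->
        (forall v, S (p v)) -> (forall e, S (s e)) -> S = setT
    & forall (B : cstar_algebra R) (q : vert E -> B) (t : edge E -> B),
        ck_family q t -> exists f : A -> B,
          [/\ star_hom f, forall v, f (p v) = q v & forall e, f (s e) = t e]].

Definition s_path (A : cstar_algebra R) (p : vert E -> A) (s : edge E -> A)
    (mu : fpath E) : A :=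
  match fedges mu with
  | [::] => p (fsrc mu)
  | e :: es => foldl (fun a f => a ** s f) (s e) es
  end.

Definition graph_diagonal (A : cstar_algebra R) (p : vert E -> A) (s : edge E -> A) : set A :=
  closure (linear_span [set s_path p s mu ** (s_path p s mu)^# | mu in [set: fpath E]]).

End GraphFamilies.
End CStar.

(* Main.v *)
(* Replacing C*-algebras of groupoids by explicit formulas: let h be a conjugacy
   with inverse g. A Cuntz-Krieger F-family (q, t) represents the integer
   combinations of indicators of cylinders of the boundary path space of F by
   1_{Z(nu)} |-> t_nu t_nu^*; this is well defined because, by induction on path
   length, a relation between indicators already follows from the Cuntz-Krieger
   relations. Let P(U) be the projection of a compact open U. By compactness of
   Z(e), the set U_e := h(Z(e)) is compact open and meets finitely many Z(f), and
   p'_v := P(h(Z(v))), s'_e := \sum_f P(U_e) t_f is a Cuntz-Krieger E-family: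
   the shift is injective on U_e, so that s'_e implements it there. The
   universal property gives Phi : C^*(E) -> C^*(F) and symmetrically Psi, and
   both composites fix the generators. They are the identity because
   *-homomorphisms are continuous, for which there is a short argument: if a is
   self-adjoint and small, then a + i sqrt(1 - a^2) is unitary, and a relation
   defining unitaries bounds the norm of its image. *)
Require Import Defs.
From HB Require Import structures.
From mathcomp Require Import all_boot all_order all_algebra.
From mathcomp Require Import complex.
From mathcomp Require Import all_classical all_reals all_analysis.
From mathcomp Require Import zify ring.
(* The analysis library also defines [shift]. *)
Import Defs.

Set Implicit Arguments.
Unset Strict Implicit.
Unset Printing Implicit Defensive.

Import Order.TTheory GRing.Theory Num.Theory.
Import numFieldNormedType.Exports.

Local Open Scope classical_set_scope.
Local Open Scope ring_scope.
Local Open Scope cstar_scope.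

(** * Automatic continuity of *-homomorphisms *)

Section CStarArithmetic.
Variables (R : realType) (A : cstar_algebra R).
Implicit Types (a b c : A).

(** Right multiplication under its own head symbol, on which the additive structure below can be
    registered. *)
Definition mulr_by b a : A := a ** b.

Lemma cs_mul_is_zmod a : zmod_morphism (@cs_mul R A a).
Proof.
move=> x y; rewrite cs_mulDr; congr (_ + _).
by rewrite -scaleN1r cs_scaleAr scaleN1r.
Qed.
HB.instance Definition _ a :=
  GRing.isZmodMorphism.Build A A (@cs_mul R A a) (@cs_mul_is_zmod a).

Lemma mulr_by_is_zmod b : zmod_morphism (mulr_by b).
Proof.
move=> x y; rewrite /mulr_by cs_mulDl; congr (_ + _).
by rewrite -scaleN1r cs_scaleAl scaleN1r.
Qed.
HB.instance Definition _ b :=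
  GRing.isZmodMorphism.Build A A (mulr_by b) (@mulr_by_is_zmod b).

Lemma cs_star_is_zmod : zmod_morphism (@cs_star R A).
Proof.
move=> x y; rewrite cs_starD; congr (_ + _).
by rewrite -scaleN1r cs_starZ rmorphN rmorph1 scaleN1r.
Qed.
HB.instance Definition _ :=
  GRing.isZmodMorphism.Build A A (@cs_star R A) cs_star_is_zmod.

Lemma csmul0 a : a ** 0 = 0. Proof. exact: raddf0. Qed.
Lemma cs0mul a : 0 ** a = 0. Proof. exact: (raddf0 (mulr_by a)). Qed.
Lemma csmulN a b : a ** (- b) = - (a ** b). Proof. exact: raddfN. Qed.
Lemma csNmul a b : (- a) ** b = - (a ** b). Proof. exact: (raddfN (mulr_by b)). Qed.
Lemma csmulB a b c : a ** (b - c) = a ** b - a ** c. Proof. exact: raddfB. Qed.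
Lemma csBmul a b c : (a - b) ** c = a ** c - b ** c.
Proof. exact: (raddfB (mulr_by c)). Qed.
Lemma csmulMz a b (n : int) : a ** (b *~ n) = (a ** b) *~ n.
Proof. exact: raddfMz. Qed.
Lemma csMzmul a b (n : int) : (a *~ n) ** b = (a ** b) *~ n.
Proof. exact: (raddfMz (mulr_by b)). Qed.
Lemma csmul_suml (I : Type) (r : seq I) (P : pred I) (f : I -> A) b :
  (\sum_(i <- r | P i) f i) ** b = \sum_(i <- r | P i) f i ** b.
Proof. exact: (raddf_sum (mulr_by b)). Qed.
Lemma csmul_sumr (I : Type) (r : seq I) (P : pred I) (f : I -> A) b :
  b ** (\sum_(i <- r | P i) f i) = \sum_(i <- r | P i) b ** f i.
Proof. exact: raddf_sum. Qed.

Lemma csstar0 : (0 : A)^# = 0. Proof. exact: raddf0. Qed.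
Lemma csstarN a : (- a)^# = - a^#. Proof. exact: raddfN. Qed.
Lemma csstarB a b : (a - b)^# = a^# - b^#. Proof. exact: raddfB. Qed.
Lemma csstarMz a (n : int) : (a *~ n)^# = a^# *~ n. Proof. exact: raddfMz. Qed.
Lemma csstar_sum (I : Type) (r : seq I) (P : pred I) (f : I -> A) :
  (\sum_(i <- r | P i) f i)^# = \sum_(i <- r | P i) (f i)^#.
Proof. exact: raddf_sum. Qed.

Lemma cs_norm_star a : `|a^#| = `|a|.
Proof.
have le_star b : `|b| <= `|b^#|.
  have [->|b0] := eqVneq b 0; first by rewrite normr0.
  rewrite -(@ler_pM2r _ `|b|) ?normr_gt0 // -expr2 -cs_normC; exact: cs_normM.
by apply/eqP; rewrite eq_le le_star -{2}(cs_starK a) le_star.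
Qed.

(** Used to pass to the limit: an identity satisfied by the iterates holds for their limit up to an
    error [M * e], for every positive [e]. *)
Lemma eq0_norm_small (M : R[i]) a : 0 < M -> (forall e, 0 < e -> `|a| <= M * e) -> a = 0.
Proof.
move=> M0 H; apply/eqP; rewrite -normr_le0; apply: contraT => na.
have a0 : 0 < `|a| by rewrite normr_gt0; apply: contra na => /eqP->; rewrite normr0.
have := H (`|a| / M / 2); rewrite !divr_gt0 // => /(_ isT).
have -> : M * (`|a| / M / 2) = `|a| / 2 by field; rewrite gt_eqF.
rewrite ler_pdivlMr // mulr_natr mulr2n.
by rewrite gerDl (negbTE na).
Qed.

(** A positive element of [R[i]] has zero imaginary part, so this reduces to the archimedean
    property of [R]. *)
Lemma exp_half_small (e : R[i]) : 0 < e -> exists n, (2^-1 : R[i]) ^+ n < e.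
Proof.
case: e => x y; rewrite ltcE /= => /andP[/eqP y0 x0].
have [n nP] : exists n : nat, x^-1 < n%:R.
  by exists (Num.truncn x^-1).+1; rewrite truncnS_gt.
have n0 : 0 < (n%:R : R) by apply: lt_trans nP; rewrite invr_gt0.
exists n; rewrite y0 -[Complex x 0]/(x%:C)%C.
have -> : (2^-1 : R[i]) = ((2^-1 : R)%:C)%C by rewrite fmorphV rmorph_nat.
rewrite -rmorphXn ltcR exprVn invf_plt ?posrE ?exprn_gt0 //.
apply: (lt_trans nP); rewrite -natrX ltr_nat; exact: ltn_expl.
Qed.

(* The fixed point [c] is [sqrt (1 - a^2) - 1], so that [a + i (1 + c)] would
   be unitary in the unitization. *)
Lemma cs_sqrt_exists a : a^# = a -> `|a| <= 2^-1 ->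
  exists c, [/\ c^# = c, a ** c = c ** a & c + c = - (a ** a + c ** c)].
Proof.
move=> sa na; have h0 : (0 : R[i]) <= 2^-1 by rewrite invr_ge0 ler0n.
(* Expanding (1 + c)^2 = 1 - a^2 eliminates the unit and says that c is a fixed point of [T]. The
   iteration [y] stays in the ball of radius 1/2. *)
pose T c := - ((2^-1 : R[i]) *: (a ** a + c ** c)).
pose y n := iter n T 0.
have sqr_le b : `|b| <= 2^-1 -> `|b ** b| <= 2^-1 * 2^-1.
  by move=> nb; apply: (le_trans (cs_normM _ _)); exact: ler_pM.
have Tball c : `|c| <= 2^-1 -> `|T c| <= 2^-1.
  move=> nc; rewrite normrN normrZ ger0_norm // ger_pMr ?invr_gt0 ?ltr0n //.
  apply: (le_trans (ler_normD _ _)).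
  apply: (le_trans (lerD (sqr_le _ na) (sqr_le _ nc))).
  by rewrite -mulrDl -[2^-1 + _]mulr2n -[_ *+ 2]mulr_natr mulVf ?pnatr_eq0 // mul1r
    invf_le1 ?ltr0n // ler1n.
have yball n : `|y n| <= 2^-1.
  by elim: n => [|n IH]; [rewrite normr0|exact: Tball].
(* [K] is left free: on the ball of radius 1/2 it is 1 and [T] contracts by 1/2, whereas the
   comparison with the limit uses [K] = 2. *)
have Tlip c d (K : R[i]) : `|c| + `|d| <= K -> `|T c - T d| <= 2^-1 * K * `|c - d|.
  move=> nK; rewrite /T -opprB opprK addrC -scalerBr normrN normrZ ger0_norm //.
  rewrite -mulrA ler_pM2l ?invr_gt0 ?ltr0n // opprD addrACA subrr add0r.
  have -> : c ** c - d ** d = c ** (c - d) + (c - d) ** d.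
    by rewrite csmulB csBmul addrA subrK.
  apply: (le_trans (ler_normD _ _)); apply: (le_trans (lerD (cs_normM _ _) (cs_normM _ _))).
  by rewrite [X in _ + X]mulrC -mulrDl ler_wpM2r.
have half1 : (2^-1 + 2^-1 : R[i]) <= 1.
  by rewrite -mulr2n -[_ *+ 2]mulr_natr mulVf ?pnatr_eq0.
have ydist n m : `|y n - y (n + m)%N| <= 2^-1 ^+ n.
  elim: n => [|n IH].
    rewrite sub0r normrN expr0; apply: (le_trans (yball _)).
    by rewrite invf_le1 ?ltr0n // ler1n.
  rewrite exprS; apply: (le_trans (Tlip _ _ 1 (le_trans (lerD (yball _) (yball _)) half1))).
  by rewrite mulr1 ler_pM2l ?invr_gt0 ?ltr0n.
have ysa n : (y n)^# = y n.
  elim: n => [|n IH]; first by rewrite csstar0.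
  rewrite /= /T csstarN cs_starZ cs_starD !cs_starM sa IH.
  by rewrite geC0_conj.
have yac n : a ** y n = y n ** a.
  elim: n => [|n IH]; first by rewrite csmul0 cs0mul.
  rewrite /= -/(y n) /T csmulN csNmul cs_scaleAr cs_scaleAl cs_mulDr cs_mulDl.
  by rewrite !cs_mulA IH -[y n ** a ** y n]cs_mulA IH cs_mulA.
have ycvg : cvgn y.
  apply/cauchy_cvgP; apply/cauchy_ballP => e e0; near_simpl.
  have [N Ne] := exp_half_small e0.
  exists ([set n | N <= n], [set n | N <= n])%N; first by split; exists N.
  move=> [n m] /= [Nn Nm]; rewrite -ball_normE /=.
  have half_dec k : (N <= k)%N -> 2^-1 ^+ k <= 2^-1 ^+ N :> R[i].
    by move=> Nk; rewrite ler_wiXn2l // invf_le1 ?ltr0n // ler1n.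
  have [nm|/ltnW mn] := leqP n m.
    rewrite -(subnKC nm); apply: (le_lt_trans (ydist _ _)).
    exact: le_lt_trans (half_dec _ Nn) Ne.
  rewrite distrC -(subnKC mn); apply: (le_lt_trans (ydist _ _)).
  exact: le_lt_trans (half_dec _ Nm) Ne.
have [c yc] : exists c, y @ \oo --> c by exists (limn y).
have close e : 0 < e -> exists n, `|c - y n| <= e /\ `|c - y n.+1| <= e.
  move=> e0; move/cvgrPdist_le : yc => /(_ e e0)[N _ HN].
  by exists N; split; apply: HN => /=.
exists c.
have cT : c = T c.
  apply/subr0_eq/(@eq0_norm_small 3); rewrite ?ltr0n // => e e0.
  (* The error is capped at 1, so that the crude bound |c| <= 1/2 + d still gives
     [|y n| + |c| <= 2]. *)
  have m0 : 0 < Num.min e 1 :> R[i] by rewrite minEle; case: ifP.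
  have me : Num.min e 1 <= e :> R[i].
    rewrite minEle; case: ifP => // h.
    by move/negbT: h; rewrite -real_ltNge ?real1 ?gtr0_real // => /ltW.
  have m1 : Num.min e 1 <= 1 :> R[i] by rewrite minEle; case: ifP.
  move: (Num.min e 1) m0 me m1 => d d0 de d1.
  have [n [d_n d_n1]] := close _ d0.
  have nc : `|c| <= 2^-1 + d.
    rewrite -(subrK (y n) c) addrC; apply: (le_trans (ler_normD _ _)).
    exact: lerD.
  have -> : c - T c = (c - y n.+1) + (T (y n) - T c) by rewrite addrA subrK.
  apply: (le_trans (ler_normD _ _)).
  have /Tlip : `|y n| + `|c| <= 2.
    apply: (le_trans (lerD (yball _) nc)); rewrite addrA -[2]/(1 + 1).
    exact: lerD.
  rewrite mulVf ?pnatr_eq0 // mul1r [X in _ <= X]distrC => nT.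
  apply: (@le_trans _ _ (d + d)); first by rewrite lerD // (le_trans nT).
  apply: (le_trans (lerD de de)).
  rewrite -subr_ge0; have -> : 3 * e - (e + e) = e by ring.
  exact: ltW.
split; last first.
- rewrite [in LHS]cT /T -opprD -scalerDl -mulr2n -[_ *+ 2]mulr_natr.
  by rewrite mulVf ?pnatr_eq0 // scale1r.
- apply/subr0_eq/(@eq0_norm_small 2); rewrite ?ltr0n // => e e0.
  have [n [d_n _]] := close _ e0.
  have -> : a ** c - c ** a = a ** (c - y n) - (c - y n) ** a.
    by rewrite csmulB csBmul yac opprB addrA subrK.
  apply: (le_trans (ler_normB _ _)); rewrite mulr_natl mulr2n.
  apply: lerD; apply: (le_trans (cs_normM _ _)); last rewrite mulrC.
    rewrite -[leRHS]mul1r ler_pM //.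
    by apply: (le_trans na); rewrite invf_le1 ?ltr0n // ler1n.
  rewrite -[leRHS]mul1r ler_pM //.
  by apply: (le_trans na); rewrite invf_le1 ?ltr0n // ler1n.
- apply/subr0_eq/(@eq0_norm_small 2); rewrite ?ltr0n // => e e0.
  have [n [d_n _]] := close _ e0.
  have -> : c^# - c = (c - y n)^# - (c - y n).
    by rewrite csstarB ysa opprB addrA subrK.
  apply: (le_trans (ler_normB _ _)); rewrite mulr_natl mulr2n.
  by rewrite cs_norm_star lerD.
Qed.

End CStarArithmetic.

Section StarHomContinuity.
Variables (R : realType) (A B : cstar_algebra R) (f : A -> B).
Hypothesis fH : star_hom f.

Lemma star_hom_is_zmod : zmod_morphism f.
Proof.
case: fH => fD fZ _ _ x y; rewrite fD; congr (_ + _).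
by rewrite -scaleN1r fZ scaleN1r.
Qed.

Lemma star_hom0 : f 0 = 0.
Proof. by case: fH => _ fZ _ _; rewrite -(scale0r 0) fZ scale0r. Qed.

Lemma star_hom_sa_bound a : a^# = a -> `|a| <= 2^-1 -> `|f a| <= 2.
Proof.
move=> sa na; have [c [sc ac cE]] := cs_sqrt_exists sa na.
case: fH => fD fZ fM fS.
have {}sa : (f a)^# = f a by rewrite -fS sa.
have {}sc : (f c)^# = f c by rewrite -fS sc.
have {}ac : f a ** f c = f c ** f a by rewrite -!fM ac.
have {}cE : f a ** f a + f c ** f c = - (f c + f c).
  have -> : - (f c + f c) = f ((-1) *: (c + c)) by rewrite fZ fD scaleN1r.
  by rewrite -!fM -!fD cE scaleN1r opprK.
move: (f a) (f c) sa sc ac cE => {na}b d sb sd bd dE.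
pose w := b + 'i *: d.
have wS : w^# = b - 'i *: d.
  by rewrite cs_starD cs_starZ sb sd conjCi scaleNr.
have bE : b = 2^-1 *: (w + w^#).
  rewrite wS addrACA subrr addr0 -mulr2n -[b *+ 2]scaler_nat scalerA.
  by rewrite mulVf ?pnatr_eq0 // scale1r.
have dwE : d + d = - 'i *: (w - w^#).
  have -> : w - w^# = 'i *: d + 'i *: d by rewrite wS opprB addrC /w addrA subrK.
  rewrite -scalerDr scalerA mulNr -expr2 sqrCi opprK scale1r //.
have nw : `|w^# ** w| <= 2 * `|w|.
  have -> : w^# ** w = - (d + d).
    rewrite -dE wS /w csBmul !cs_mulDr !cs_scaleAr !cs_scaleAl scalerA.
    rewrite -expr2 sqrCi scaleN1r bd opprD opprK addrA addrK //.
  rewrite normrN dwE normrZ normrN normCi mul1r mulr_natl mulr2n.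
  by apply: (le_trans (ler_normB _ _)); rewrite cs_norm_star.
have {}nw : `|w| <= 2.
  have [->|w0] := eqVneq w 0; first by rewrite normr0 ler0n.
  by move: nw; rewrite cs_normC expr2 ler_pM2r ?normr_gt0.
rewrite bE normrZ ger0_norm ?invr_ge0 ?ler0n //.
rewrite -[leRHS](@mulKf _ (2 : R[i])) ?pnatr_eq0 // ler_pM2l ?invr_gt0 ?ltr0n //.
apply: (le_trans (ler_normD _ _)); rewrite cs_norm_star.
by rewrite mulr_natl mulr2n lerD.
Qed.

Lemma star_hom_bound a : `|f a| <= 2 * `|a|.
Proof.
have [fD fZ fM fS] := fH.
have [->|a0] := eqVneq a 0; first by rewrite star_hom0 !normr0 mulr0.
have na0 : 0 < `|a| by rewrite normr_gt0.
(* This factor scales a^* a, of norm |a|^2, to norm 1/2; the C*-identity in [B] then gives |f a|^2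
   <= 4 |a|^2. *)
pose k : R[i] := (2 * `|a| ^+ 2)^-1.
have k0 : 0 < k by rewrite invr_gt0 mulr_gt0 ?ltr0n // exprn_gt0.
have : `|f (k *: (a^# ** a))| <= 2.
  apply: star_hom_sa_bound.
    rewrite cs_starZ cs_starM cs_starK; congr (_ *: _).
    by apply/CrealP; exact: gtr0_real.
  rewrite normrZ cs_normC gtr0_norm // /k invfM -mulrA mulVf ?mulr1 //.
  by rewrite gt_eqF // exprn_gt0.
rewrite fZ normrZ gtr0_norm // fM fS cs_normC /k mulrC ler_pdivrMr; last first.
  by rewrite mulr_gt0 ?ltr0n // exprn_gt0.
rewrite mulrA -expr2 -exprMn; rewrite ler_pXn2r // ?nnegrE ?mulr_ge0 //.
Qed.

Lemma star_hom_continuous : continuous f.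
Proof.
move=> x; apply/cvgrPdist_le => e e0.
near=> y; rewrite -star_hom_is_zmod; apply: (le_trans (star_hom_bound _)).
rewrite mulrC -ler_pdivlMr ?ltr0n //.
near: y; apply: cvgr_dist_le; first exact: cvg_id.
by rewrite divr_gt0 ?ltr0n.
Unshelve. all: by end_near.
Qed.

End StarHomContinuity.

(** * Compactness of cylinders *)

Section Cylinders.
Variable E : digraph.
Implicit Types (x y : bpath E) (v w : vert E) (e f : edge E) (es fs : seq (edge E)).

Definition starts_with e x : bool := bprefix 1 x == [:: e].

(** A boolean form of [Z] that reads the path edge by edge along the shift, for inductions on path
    length. The data need not form a path; if they do not, the cylinder is empty. *)
Fixpoint cyl v es x : bool :=
  if es is e :: es' then [&& src e == v, starts_with e x & cyl (rng e) es' (shift x)]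
  else bsrc x == v.

Lemma starts_with_src e x : starts_with e x -> bsrc x = src e.
Proof.
rewrite /starts_with.
case: x => [[v [|f fs] p] s|x] //= /eqP[<-] //.
by have /andP[/eqP] := p.
Qed.

Lemma starts_with_len e x : starts_with e x -> blen_ge 1 x.
Proof. by move=> /eqP h; apply/blen_geP; rewrite h. Qed.

Lemma starts_with_shift e x : starts_with e x -> bsrc (shift x) = rng e.
Proof.
move=> h; rewrite -[shift x]/(iter 1 (@shift E) x) bsrc_iter.
  by move/eqP: h => ->.
exact: starts_with_len h.
Qed.

Lemma starts_with_Z e x : starts_with e x <-> Z (fedge e) x.
Proof.
rewrite ZP; split=> [h|[_ /eqP]] //.
by split; [exact: starts_with_src|exact/eqP].
Qed.

Lemma starts_with_uniq e f x : starts_with e x -> starts_with f x -> e = f.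
Proof. by rewrite /starts_with => /eqP-> /eqP[]. Qed.

Lemma starts_with_exists x : blen_ge 1 x -> exists e, starts_with e x.
Proof.
move=> /blen_geP; rewrite /starts_with; case: (bprefix 1 x) => [|e [|//]] // _.
by exists e.
Qed.

Lemma starts_with_inj e x y :
  starts_with e x -> starts_with e y -> shift x = shift y -> x = y.
Proof.
move=> /starts_with_Z Zx /starts_with_Z Zy xy.
by apply: (@shift_inj _ (fedge e)); rewrite ?inE.
Qed.

Lemma econs e y : bsrc y = rng e -> exists2 x, starts_with e x & shift x = y.
Proof.
move=> h; have h' : bsrc y = frng (fedge e) by [].
exists (bcat h'); last exact: (shift_bcat h').
by apply/starts_with_Z; exists y, h'.
Qed.

Lemma cyl_src v es x : cyl v es x -> bsrc x = v.
Proof.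
by case: es => [/eqP//|e es /= /and3P[/eqP<- /starts_with_src]].
Qed.

Lemma cylP v es x :
  cyl v es x <-> [/\ chain v es, bsrc x = v & bprefix (size es) x = es].
Proof.
elim: es v x => [|e es IH] v x /=.
  have -> : bprefix 0 x = [::] by case: x => //= mu _; rewrite take0.
  by split=> [/eqP|[_ ->]].
have hd : bprefix 1 x = take 1 (bprefix (size es).+1 x) by rewrite take_bprefix.
split=> [/and3P[/eqP ev ex /IH[-> _ px]]|[/andP[/eqP ev c] sx px]].
  split; [by rewrite ev eqxx|by rewrite -ev; exact: starts_with_src|].
  move: ex; rewrite /starts_with hd; move: px; rewrite bprefix_shift.
  by case: (bprefix (size es).+1 x) => //= f fs -> /eqP[->].
have ex : starts_with e x by rewrite /starts_with hd px /= take0.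
rewrite ev eqxx ex /=; apply/IH; split=> //; first exact: starts_with_shift.
by rewrite bprefix_shift px.
Qed.

Lemma Z_cyl (mu : fpath E) x : Z mu x <-> cyl (fsrc mu) (fedges mu) x.
Proof.
rewrite ZP cylP; split=> [[]|[_]] //.
by split=> //; exact: fpathP.
Qed.

Lemma Z_fcat (mu nu : fpath E) (h : fsrc nu = frng mu) x :
  Z (fcat h) x <-> Z mu x /\ Z nu (iter (flen mu) (@shift E) x).
Proof. by rewrite -[Z (fcat h)]Zminus0 -[Z nu]Zminus0; exact: Zminus_fcat. Qed.

Lemma Z_step (mu : fpath E) x : Z mu x -> blen_ge (flen mu).+1 x ->
  exists e (h : fsrc (fedge e) = frng mu), Z (fcat h) x.
Proof.
move=> /[dup] Zx /ZP[sx px] /bpath_split[nu /[dup] Zn /ZP[sn pn] nl].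
have [mu1 [mu2 [h [nuE m1]]]] := @fpath_split _ nu (flen mu) ltac:(by rewrite nl).
have mE : mu1 = mu.
  subst nu; case/Z_fcat: Zn => /ZP[s1 p1] _; apply: fpath_eq.
    by rewrite -s1.
  by rewrite -p1 m1.
subst mu1 nu.
have : flen mu2 = 1%N by move: nl; rewrite /flen /= size_cat -addn1 => /addnI.
case: mu2 h Zn {sn pn nl} => w [|e [|//]] //= p h Zn _.
have pe : src e = w by have /andP[/eqP] := p.
have h' : fsrc (fedge e) = frng mu by rewrite /= pe.
exists e, h'; suff -> : fcat h' = @fcat E mu (@FPath E w [:: e] p) h by [].
exact: fpath_eq.
Qed.

(** Dependent choice extends [mu] one edge at a time inside [P]; the chosen edges, appended to [mu],
    form the infinite path. In the compactness proof, [P] says that a cylinder has no finite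
    cover. *)
Lemma infinite_branch (P : fpath E -> Prop) (mu : fpath E) : P mu ->
  (forall nu, P nu -> exists e (h : fsrc (fedge e) = frng nu), P (fcat h)) ->
  exists x, forall n, exists2 nu, P nu & Z nu x /\ flen nu = (flen mu + n)%N.
Proof.
move=> Pmu step.
have nxt (nu : {nu | P nu}) : {nu' : {nu | P nu} |
    exists e (h : fsrc (fedge e) = frng (sval nu)), sval nu' = fcat h}.
  apply: cid; case: nu => nu Pnu; have [e [h Ph]] := step nu Pnu.
  by exists (exist _ _ Ph), e, h.
have [f [f0 fS]] := dependent_choice nxt (exist _ mu Pmu).
pose g n := sval (f n).
have /choice[es esP] : forall n, exists e, src e = frng (g n) /\
    fedges (g n.+1) = rcons (fedges (g n)) e /\ fsrc (g n.+1) = fsrc (g n).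
  by move=> n; have [e [h gE]] := fS n; exists e; rewrite /g gE /= cats1.
have esC i : rng (es i) = src (es i.+1).
  have [_ [gi _]] := esP i; have [-> _] := esP i.+1.
  by rewrite /frng gi map_rcons last_rcons.
have g0 : g 0 = mu by rewrite /g f0.
pose y := BInf (IPath esC).
have hy : bsrc y = frng mu by rewrite /= -g0; case: (esP 0).
exists (bcat hy) => n; exists (g n); first exact: svalP (f n).
have gsrc : fsrc (g n) = fsrc mu.
  by elim: n => [|n <-]; [rewrite g0|case: (esP n) => _ []].
have gedges : fedges (g n) = fedges mu ++ mkseq es n.
  elim: n {gsrc} => [|n IH]; first by rewrite g0 cats0.
  by have [_ [-> _]] := esP n; rewrite IH rcons_cat /mkseq -addn1 iotaD map_cat cats1.
split; last by rewrite /flen gedges size_cat size_mkseq.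
have c : chain (frng mu) (mkseq es n).
  by have := fpathP (g n); rewrite gsrc gedges chain_cat => /andP[].
have -> : g n = fcat (erefl : fsrc (FPath c) = frng mu) by exact: fpath_eq.
apply/Z_fcat; split; first by exists y, hy.
by rewrite shift_bcat; apply/ZP; rewrite /flen /= size_mkseq.
Qed.

(* Compactness of [Z mu], as an induction principle: [Q] plays the role of
   ``covered by finitely many members of the cover''. With [Q := fun=> False]
   it yields that [Z mu] is nonempty. *)
Lemma Z_compact_ind (Q : set (bpath E) -> Prop) (mu : fpath E) :
  (forall U V, U `<=` V -> Q V -> Q U) ->
  (forall U V, Q U -> Q V -> Q (U `|` V)) ->
  (forall x, Z mu x -> exists U, [/\ open U, U x & Q U]) ->
  Q (Z mu).
Proof.
move=> Qsub QU Qloc; apply: contrapT => nQ.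
have Qfin nu (K : set (edge E)) V : finite_set K -> Q V ->
    (forall e (h : fsrc (fedge e) = frng nu), Q (Z (fcat h))) ->
    Q (V `|` [set x | exists2 e, K e & exists h : fsrc (fedge e) = frng nu, Z (fcat h) x]).
  move=> /finite_seqP[s ->] QV Qe; elim: s => [|e s IH].
    by apply: (Qsub _ V) => // x [//|[]].
  have [h|h] := pselect (fsrc (fedge e) = frng nu).
    apply: (Qsub _ _ _ (QU _ _ IH (Qe e h))) => x [Vx|[e' /= + [h' Zx]]].
      by left; left.
    rewrite inE => /orP[/eqP ee|e's]; last by left; right; exists e' => //; exists h'.
    by subst e'; right; rewrite (Prop_irrelevance h h').
  apply: (Qsub _ _ _ IH) => x [Vx|[e' /= + [h' Zx]]]; first by left.
  rewrite inE => /orP[/eqP ee|e's]; last by right; exists e' => //; exists h'.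
  by subst e'.
(* At a regular [frng nu], the cylinder is the finite union of its one-edge extensions. At a
   singular one, [nu] is itself a boundary point, and a basic neighbourhood of it is [Z nu] without
   finitely many extensions. *)
have step nu : Z nu `<=` Z mu /\ ~ Q (Z nu) ->
    exists e (h : fsrc (fedge e) = frng nu), Z (fcat h) `<=` Z mu /\ ~ Q (Z (fcat h)).
  move=> [numu nQnu]; apply: contrapT => none.
  have Qe e (h : fsrc (fedge e) = frng nu) : Q (Z (fcat h)).
    apply: contrapT => nQe; apply: none; exists e, h; split=> //.
    by move=> x /Z_fcat[/numu].
  have [[fK [e0 e0v]]|s] := pselect (regular (frng nu)).
    apply: nQnu; apply: (Qsub _ _ _ (Qfin nu _ _ fK (Qe e0 e0v) Qe)) => x Zx.
    right; have [|e [h Ze]] := @Z_step nu x Zx; last by exists e => //; exists h.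
    case: x Zx => // rho s Zx /=; rewrite ltn_neqAle (Z_len Zx) andbT.
    apply/eqP => fl; suff rE : rho = nu by apply: (s); rewrite rE; split=> //; exists e0.
    case/ZP: Zx => s' p'; apply: fpath_eq => //.
    by rewrite -p' /= fl take_size.
  pose x := BFin s.
  have Zx : Z nu x by apply/ZP; rewrite /= take_size.
  have [U [oU Ux QUU]] := Qloc x (numu _ Zx).
  have [rho [K [fK KO Zr ZU lr]]] := nbhs_Zminus oU Ux (leqnn _ : blen_ge (flen nu) x).
  have rE : rho = nu.
    case: Zr => /[dup] /Z_len /= lr' /ZP[s' p'] _; apply: fpath_eq => //.
    have := anti_leq (introT andP (conj lr lr')) => fl.
    by rewrite -p' -fl /= take_size.
  subst rho; apply: nQnu; apply: (Qsub _ _ _ (Qfin nu _ _ fK QUU Qe)) => y Zy.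
  have [|nKy] := pselect ([set x | exists2 e, K e &
     exists h : fsrc (fedge e) = frng nu, Z (fcat h) x] y); first by right.
  by left; apply: ZU.
have [x xP] := infinite_branch (conj (fun x Zx => Zx) nQ) step.
have Zx : Z mu x by have [nu [numu _] [/numu]] := xP 0.
have [U [oU Ux QUU]] := Qloc x Zx.
have /bpath_openP/(_ _ Ux) [rho [K [fK KO Zr ZU]]] := oU.
(* A branch strictly longer than [rho] also decides the edge after [rho], so its cylinder avoids the
   edges of [K]. *)
have [nu [numu nQnu] [Znu nl]] := xP (flen rho).+1.
apply: nQnu; apply: (Qsub _ U) => //; apply: subset_trans ZU.
rewrite -(Zminus0 nu); apply: Zminus_sub KO _ Zr Znu.
by rewrite nl; lia.
Qed.

Lemma Z_nonempty (mu : fpath E) : Z mu !=set0.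
Proof.
apply: contrapT => ne; apply: (@Z_compact_ind (fun=> False) mu) => // x Zx.
by exfalso; apply: ne; exists x.
Qed.

Lemma bsrc_surj v : exists x, bsrc x = v.
Proof.
have [x /ZP[sx _]] := Z_nonempty (@FPath E v [::] isT).
by exists x.
Qed.

End Cylinders.

(** * Step functions on the boundary path space and their values *)

Section StepFunctions.
Variable E : digraph.
Implicit Types (x y : bpath E) (v w : vert E) (e f : edge E) (es fs : seq (edge E)).
Implicit Types (l : seq (int * (vert E * seq (edge E)))).
Implicit Types (phi psi : bpath E -> int).

(** An entry [(n, (v, es))] of [l] stands for n times the indicator of a cylinder. Keeping the
    formal combination apart from the function lets the same [l] be evaluated in a Cuntz-Krieger
    family. *)
Definition ev l x : int := \sum_(g <- l) (cyl g.2.1 g.2.2 x)%:Z * g.1.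

Definition zscale (n : int) l := [seq (n * g.1, g.2) | g <- l].

Lemma ev_cat l l' x : ev (l ++ l') x = ev l x + ev l' x.
Proof. exact: big_cat. Qed.

Lemma ev_zscale n l x : ev (zscale n l) x = n * ev l x.
Proof. by rewrite /ev big_map mulr_sumr; apply: eq_bigr => g _; rewrite mulrCA. Qed.

(** Two cylinders over one vertex are nested or disjoint: the intersection belongs to the longer
    path if one path extends the other. *)
Fixpoint meet es fs : option (seq (edge E)) :=
  match es, fs with
  | [::], _ => Some fs
  | _, [::] => Some es
  | e :: es', f :: fs' => if e == f then omap (cons e) (meet es' fs') else None
  end.

Lemma cyl_meet v es w fs x : cyl v es x && cyl w fs x =
  (v == w) && oapp (fun gs => cyl v gs x) false (meet es fs).
Proof.
have [<-|vw] /= := eqVneq v w; last first.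
  by apply/negP => /andP[/cyl_src hv /cyl_src hw]; rewrite -hv -hw eqxx in vw.
elim: es fs v x => [|e es IH] [|f fs] v x.
- by rewrite /= andbb.
- rewrite [meet _ _]/= [oapp _ _ _]/=; apply/andP/idP => [[]//|h]; split=> //.
  by rewrite /= (@cyl_src E v (f :: fs) x h).
- rewrite [meet _ _]/= [oapp _ _ _]/=; apply/andP/idP => [[]//|h]; split=> //.
  by rewrite /= (@cyl_src E v (e :: es) x h).
rewrite /=; have [<-|ef] := eqVneq e f.
  have := IH fs (rng e) (shift x); case: (meet es fs) => [gs|] /=.
    by move=> <-; case: (_ == _); case: starts_with; rewrite //= andbF.
  by move=> h; apply/negP => /andP[/and3P[_ _ a] /and3P[_ _ b]]; rewrite a b in h.
apply/negP => /andP[/and3P[_ /starts_with_uniq a _] /and3P[_ /a h _]].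
by rewrite h eqxx in ef.
Qed.

Definition meets l l' : seq (int * (vert E * seq (edge E))) :=
  flatten [seq flatten [seq if g.2.1 == g'.2.1 then
                oapp (fun gs => [:: (g.1 * g'.1, (g.2.1, gs))]) [::] (meet g.2.2 g'.2.2)
              else [::] | g' <- l'] | g <- l].

Lemma big_flatten_map (V : nmodType) (I J : Type) (r : seq I) (F : I -> seq J) (G : J -> V) :
  \sum_(j <- flatten [seq F i | i <- r]) G j = \sum_(i <- r) \sum_(j <- F i) G j.
Proof. by rewrite big_flatten big_map. Qed.

Lemma ev_meets l l' x : ev (meets l l') x = ev l x * ev l' x.
Proof.
rewrite /ev big_flatten_map mulr_suml; apply: eq_bigr => g _.
rewrite big_flatten_map mulr_sumr; apply: eq_bigr => g' _.
have := cyl_meet g.2.1 g.2.2 g'.2.1 g'.2.2 x.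
rewrite mulrACA -PoszM mulnb => ->.
case: eqP => _ /=; last by rewrite big_nil mul0r.
by case: meet => [gs|] /=; rewrite ?big_seq1 // big_nil mul0r.
Qed.

(** The function y |-> (ev l)(e y) on the paths y that can follow e, extended by 0. It mirrors a |->
    s_e^* a s_e in a family, as [push] mirrors a |-> s_e a s_e^*. *)
Definition pull e l : seq (int * (vert E * seq (edge E))) :=
  flatten [seq if g.2.1 == src e then
      (if g.2.2 is f :: fs then (if e == f then [:: (g.1, (rng e, fs))] else [::])
       else [:: (g.1, (rng e, [::]))]) else [::] | g <- l].

Lemma ev_pull e l x : starts_with e x -> ev (pull e l) (shift x) = ev l x.
Proof.
move=> ex; rewrite /ev big_flatten_map; apply: eq_bigr => -[c [v es]] _ /=.
case: es => [|f fs] /=; rewrite ?(starts_with_src ex) (eq_sym v).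
  case: eqP => _; last by rewrite big_nil mul0r.
  by rewrite big_seq1 /= (starts_with_shift ex) eqxx.
have [<-|ef] := eqVneq e f.
  by case: eqP => _; rewrite ?big_nil ?mul0r // big_seq1 ex.
rewrite if_same big_nil; have [/(starts_with_uniq ex)/eqP|] := boolP (starts_with f x).
  by rewrite (negbTE ef).
by rewrite andbF mul0r.
Qed.

Lemma ev_pull0 e l y : bsrc y != rng e -> ev (pull e l) y = 0.
Proof.
move=> ye; rewrite /ev big_flatten_map big1 // => -[c [v es]] _ /=.
have nc fs : cyl (rng e) fs y = false.
  by apply/negP => /cyl_src h; rewrite h eqxx in ye.
case: ifP => _; last by rewrite big_nil.
case: es => [|f fs]; first by rewrite big_seq1 nc mul0r.
by case: ifP => _; rewrite ?big_nil // big_seq1 nc mul0r.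
Qed.

Definition push e l : seq (int * (vert E * seq (edge E))) :=
  [seq (g.1, (src e, e :: g.2.2)) | g <- l & g.2.1 == rng e].

Lemma ev_push e l x :
  ev (push e l) x = (starts_with e x)%:Z * ev l (shift x).
Proof.
rewrite /ev big_map big_filter big_mkcond mulr_sumr; apply: eq_bigr => -[c [v es]] _ /=.
rewrite eqxx /=; case: eqP => [->|vr]; first by rewrite mulrA -PoszM mulnb.
have [/starts_with_shift sx|_] := boolP (starts_with e x); last by rewrite mul0r.
suff -> : cyl v es (shift x) = false by rewrite mul0r mulr0.
by apply/negP => /cyl_src; rewrite sx => h; apply: vr.
Qed.

(* The integer combinations of indicator functions of cylinders, which are in
   fact the compactly supported locally constant functions. *)
Definition is_step phi := exists l, phi =1 ev l.

Definition ind (U : pred (bpath E)) x : int := (U x)%:Z.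
Definition is_clopen (U : pred (bpath E)) := is_step (ind U).

Lemma is_step0 : is_step (fun=> 0).
Proof. by exists [::] => x; rewrite /ev big_nil. Qed.

Lemma is_stepD phi psi : is_step phi -> is_step psi -> is_step (fun x => phi x + psi x).
Proof. by move=> [l lE] [l' lE']; exists (l ++ l') => x; rewrite ev_cat lE lE'. Qed.

Lemma is_stepZ n phi : is_step phi -> is_step (fun x => n * phi x).
Proof. by move=> [l lE]; exists (zscale n l) => x; rewrite ev_zscale lE. Qed.

Lemma is_stepM phi psi : is_step phi -> is_step psi -> is_step (fun x => phi x * psi x).
Proof. by move=> [l lE] [l' lE']; exists (meets l l') => x; rewrite ev_meets lE lE'. Qed.

Lemma is_step_sum (I : Type) (r : seq I) (phi : I -> bpath E -> int) :
  (forall i, is_step (phi i)) -> is_step (fun x => \sum_(i <- r) phi i x).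
Proof.
move=> H; elim: r => [|i r IH].
  by have [l lE] := is_step0; exists l => x; rewrite -lE big_nil.
by have [l lE] := is_stepD (H i) IH; exists l => x; rewrite -lE big_cons.
Qed.

Lemma eq_is_step phi psi : phi =1 psi -> is_step phi -> is_step psi.
Proof. by move=> e [l lE]; exists l => x; rewrite -e lE. Qed.

Lemma is_clopen_cyl v es : is_clopen (cyl v es).
Proof. by exists [:: (1, (v, es))] => x; rewrite /ev big_seq1 /= mulr1. Qed.

Lemma is_clopenI U V : is_clopen U -> is_clopen V -> is_clopen (fun x => U x && V x).
Proof.
move=> hU hV; apply: eq_is_step (is_stepM hU hV) => x.
by rewrite /ind -PoszM mulnb.
Qed.

Lemma is_clopenD U V : is_clopen U -> is_clopen V -> is_clopen (fun x => U x && ~~ V x).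
Proof.
move=> hU hV; apply: eq_is_step (is_stepD hU (is_stepZ (-1) (is_stepM hU hV))) => x.
by rewrite /ind; case: (U x); case: (V x).
Qed.

Lemma is_clopenU U V : is_clopen U -> is_clopen V -> is_clopen (fun x => U x || V x).
Proof.
move=> hU hV; apply: eq_is_step (is_stepD hU (is_clopenD hV hU)) => x.
by rewrite /ind; case: (U x); case: (V x).
Qed.

Lemma is_clopen0 : is_clopen (fun=> false).
Proof. exact: is_step0. Qed.

Lemma is_clopen_starts e : is_clopen (starts_with e).
Proof.
apply: eq_is_step (is_clopen_cyl (src e) [:: e]) => x; rewrite /ind /= eqxx /=.
case: (boolP (starts_with e x)) => // /starts_with_shift ->.
by rewrite eqxx.
Qed.

(* [pullback e U] is [shift (U `&` Z e)]. *)
Definition pullback e (U : pred (bpath E)) : pred (bpath E) :=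
  fun y => `[< exists x, [/\ starts_with e x, U x & shift x = y] >].

Lemma pullback_shift e U x : starts_with e x -> pullback e U (shift x) = U x.
Proof.
move=> ex; apply/asboolP/idP => [[x' [ex' Ux' xx']]|Ux]; last by exists x.
by rewrite -(starts_with_inj ex' ex xx').
Qed.

Lemma pullback_src e U y : pullback e U y -> bsrc y = rng e.
Proof. by move=> /asboolP[x [/starts_with_shift <- _ ->]]. Qed.

Lemma ev_pullback e U l : ind U =1 ev l -> ind (pullback e U) =1 ev (pull e l).
Proof.
move=> UE y; have [ye|ye] := eqVneq (bsrc y) (rng e).
  by have [x ex <-] := econs ye; rewrite /ind pullback_shift // ev_pull // -UE.
rewrite ev_pull0 // /ind; case: (boolP (pullback e U y)) => // /pullback_src h.
by rewrite h eqxx in ye.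
Qed.

Lemma is_clopen_pullback e U : is_clopen U -> is_clopen (pullback e U).
Proof. by move=> [l lE]; exists (pull e l); exact: ev_pullback. Qed.

Lemma is_clopen_push e U : is_clopen U ->
  is_clopen (fun x => starts_with e x && U (shift x)).
Proof.
move=> [l lE]; exists (push e l) => x.
by rewrite ev_push -lE /ind -PoszM mulnb.
Qed.

End StepFunctions.

(** * Cylinder projections in a Cuntz-Krieger family *)

Section Family.
Variables (R : realType) (A : cstar_algebra R) (E : digraph).
Variables (p : vert E -> A) (s : edge E -> A).
Hypothesis ck : ck_family p s.
Implicit Types (x y : bpath E) (v w : vert E) (e f : edge E) (es fs : seq (edge E)).
Implicit Types (l : seq (int * (vert E * seq (edge E)))).
Implicit Types (phi psi : bpath E -> int).

Lemma ck_pp v w : p v ** p w = if v == w then p v else 0.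
Proof. by case: ck => -[pP p0] _ _ _ _; case: eqP => [<-|/p0//]; case: (pP v). Qed.

Lemma ck_pS v : (p v)^# = p v.
Proof. by case: ck => -[pP p0] _ _ _ _; case: (pP v). Qed.

Lemma ck_ss e f : (s e)^# ** s f = if e == f then p (rng e) else 0.
Proof. by case: ck => _ [_ s0] sr _ _; case: eqP => [<-|/s0]. Qed.

Lemma ck_sp e : s e ** p (rng e) = s e.
Proof. by case: ck => _ [pi _] sr _ _; rewrite -sr cs_mulA; exact: pi. Qed.

Lemma ck_ps v e : p v ** s e = if v == src e then s e else 0.
Proof.
have pse : p (src e) ** s e = s e.
  case: ck => _ [pi _] sr le _; rewrite -{1}(pi e) !cs_mulA -[p _ ** _ ** _]cs_mulA.
  by have [-> _] := le e; exact: pi.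
by rewrite -{1}pse cs_mulA ck_pp; case: eqP => [->|_]; rewrite ?pse ?cs0mul.
Qed.

(** This is s_mu s_mu^* for the path mu with source [v] and edges [es], or 0 if these form no path;
    the recursion is that of [cyl]. *)
Fixpoint proj v es : A :=
  if es is e :: es' then
    if src e == v then s e ** proj (rng e) es' ** (s e)^# else 0
  else p v.

Lemma proj_star v es : (proj v es)^# = proj v es.
Proof.
elim: es v => [|e es IH] v /=; first exact: ck_pS.
by case: ifP => _; rewrite ?csstar0 // !cs_starM cs_starK IH cs_mulA.
Qed.

Lemma p_proj v w es : p v ** proj w es = if v == w then proj w es else 0.
Proof.
case: es => [|e es] /=; first by rewrite ck_pp; case: eqP => // ->.
have [<-|_] := eqVneq (src e) w; last by rewrite csmul0 if_same.
by rewrite !cs_mulA ck_ps; case: eqP => // _; rewrite !cs0mul.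
Qed.

Lemma proj_p v w es : proj w es ** p v = if v == w then proj w es else 0.
Proof.
rewrite -[LHS]cs_starK cs_starM ck_pS proj_star p_proj.
by case: ifP; rewrite ?proj_star ?csstar0.
Qed.

(** The counterpart of [cyl_meet]: common first edges cancel by s_e^* s_e = p_(r(e)), and the first
    difference gives s_e^* s_f = 0. *)
Lemma proj_mul v es w fs : proj v es ** proj w fs =
  if v == w then oapp (proj v) 0 (meet es fs) else 0.
Proof.
have [<-|vw] := eqVneq v w; last first.
  have -> : proj v es = proj v es ** p v by rewrite proj_p eqxx.
  by rewrite -cs_mulA p_proj (negbTE vw) csmul0.
elim: es fs v => [|e es IH] [|f fs] v; rewrite ?p_proj ?proj_p ?eqxx //.
rewrite /=; have [<-|ev] := eqVneq (src e) v; last first.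
  rewrite cs0mul; case: eqP => // _; case: meet => //= gs.
  by rewrite (negbTE ev).
have [<-|ef] := eqVneq e f.
  rewrite eqxx !cs_mulA -[_ ** _ ** s e]cs_mulA ck_ss eqxx.
  rewrite -[_ ** proj _ es ** p _]cs_mulA proj_p eqxx -[_ ** proj _ es ** _]cs_mulA IH.
  by case: meet => [gs|] /=; rewrite ?eqxx // csmul0 cs0mul.
case: eqP => _; last by rewrite csmul0.
by rewrite !cs_mulA -[_ ** _ ** s f]cs_mulA ck_ss (negbTE ef) csmul0 !cs0mul.
Qed.

Lemma proj_comm v es w fs : proj v es ** proj w fs = proj w fs ** proj v es.
Proof.
rewrite -[LHS]cs_starK cs_starM !proj_star proj_mul.
case: eqP => // _; rewrite ?csstar0 //.
by case: meet => [gs|] /=; rewrite ?proj_star ?csstar0.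
Qed.

Lemma proj_push e v es :
  s e ** proj v es ** (s e)^# = if v == rng e then proj (src e) (e :: es) else 0.
Proof.
rewrite /= eqxx; case: eqP => [->//|/eqP vr].
by rewrite -ck_sp -[s e ** _ ** proj _ _]cs_mulA p_proj eq_sym (negbTE vr) csmul0 cs0mul.
Qed.

Lemma proj_pull e v es : (s e)^# ** proj v es ** s e =
  if v == src e then
    (if es is f :: fs then (if e == f then proj (rng e) fs else 0) else p (rng e))
  else 0.
Proof.
case: es => [|f fs] /=.
  by rewrite -cs_mulA ck_ps; case: eqP => _; rewrite ?csmul0 // ck_ss eqxx.
have [<-|ef] := eqVneq e f.
  rewrite eq_sym; case: eqP => _; last by rewrite csmul0 cs0mul.
  rewrite !cs_mulA ck_ss eqxx p_proj eqxx -cs_mulA ck_ss eqxx.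
  by rewrite proj_p eqxx.
rewrite if_same; case: eqP => _; last by rewrite csmul0 cs0mul.
by rewrite !cs_mulA ck_ss (negbTE ef) !cs0mul.
Qed.

Definition comb_val l : A := \sum_(g <- l) proj g.2.1 g.2.2 *~ g.1.

Lemma comb_val_cat l l' : comb_val (l ++ l') = comb_val l + comb_val l'.
Proof. exact: big_cat. Qed.

Lemma comb_val_zscale n l : comb_val (zscale n l) = comb_val l *~ n.
Proof.
rewrite /comb_val big_map mulrz_suml; apply: eq_bigr => g _ /=.
by rewrite mulrC mulrzA.
Qed.

Lemma comb_val_star l : (comb_val l)^# = comb_val l.
Proof.
by rewrite csstar_sum; apply: eq_bigr => g _; rewrite csstarMz proj_star.
Qed.

Lemma comb_val_meets l l' : comb_val (meets l l') = comb_val l ** comb_val l'.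
Proof.
rewrite /comb_val big_flatten_map csmul_suml; apply: eq_bigr => g _.
rewrite big_flatten_map csmul_sumr; apply: eq_bigr => g' _.
rewrite csmulMz csMzmul -mulrzA proj_mul.
case: eqP => _ /=; last by rewrite big_nil mul0rz.
by case: meet => [gs|] /=; rewrite ?big_seq1 // big_nil mul0rz.
Qed.

Lemma comb_val_pull e l : comb_val (pull e l) = (s e)^# ** comb_val l ** s e.
Proof.
rewrite /comb_val big_flatten_map csmul_sumr csmul_suml; apply: eq_bigr => -[c [v es]] _ /=.
rewrite csmulMz csMzmul proj_pull.
case: eqP => _; last by rewrite big_nil mul0rz.
case: es => [|f fs]; first by rewrite big_seq1.
by case: eqP => _; rewrite ?big_nil ?mul0rz // big_seq1.
Qed.

Lemma comb_val_push e l : comb_val (push e l) = s e ** comb_val l ** (s e)^#.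
Proof.
rewrite /comb_val big_map big_filter big_mkcond csmul_sumr csmul_suml.
apply: eq_bigr => -[c [v es]] _; rewrite csmulMz csMzmul proj_push /=.
by case: eqP => _; rewrite // mul0rz.
Qed.

Lemma proj_val v es l : proj v es ** comb_val l = comb_val l ** proj v es.
Proof.
rewrite csmul_sumr csmul_suml; apply: eq_bigr => g _.
by rewrite csmulMz csMzmul proj_comm.
Qed.

End Family.

(** * Values of step functions in a Cuntz-Krieger family *)

Section StepValues.
Variables (R : realType) (A : cstar_algebra R) (E : digraph).
Variables (p : vert E -> A) (s : edge E -> A).
Hypothesis ck : ck_family p s.
Implicit Types (x y : bpath E) (v w : vert E) (e f : edge E) (es fs : seq (edge E)).
Implicit Types (l : seq (int * (vert E * seq (edge E)))).
Implicit Types (phi psi : bpath E -> int).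
Implicit Types (U V W : pred (bpath E)).
Local Notation proj := (proj p s).
Local Notation comb_val := (comb_val p s).

Definition heads l : seq (edge E) :=
  undup (flatten [seq if g.2.2 is e :: _ then [:: e] else [::] | g <- l]).

Lemma mem_heads l g e es : g \in l -> g.2.2 = e :: es -> e \in heads l.
Proof.
move=> gl ge; rewrite mem_undup; apply/flattenP.
exists [:: e]; last by rewrite inE.
by apply/mapP; exists g; rewrite ?ge.
Qed.

Lemma csmul_eq0 (a : A) : a^# ** a = 0 -> a = 0.
Proof.
move=> h; apply/normr0_eq0/eqP.
have := cs_normC a; rewrite h normr0 => /esym/eqP.
by rewrite expf_eq0.
Qed.

Lemma big_pred1_uniq (I : eqType) (V : nmodType) (r : seq I) i (F : I -> V) :
  uniq r -> i \in r -> \sum_(j <- r | i == j) F j = F i.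
Proof.
move=> ur ir; rewrite big_mkcond (bigD1_seq i) //= eqxx big1 ?addr0 // => j ji.
by rewrite eq_sym (negbTE ji).
Qed.

Lemma proj_edge e : proj (src e) [:: e] = s e ** (s e)^#.
Proof. by rewrite /= eqxx (ck_sp ck). Qed.

(** Corresponds to the part of Z(v) that avoids the finitely many first edges occurring in [l];
    there [ev l] is constant. *)
Definition cut_proj v l : A :=
  p v - \sum_(e <- heads l | src e == v) proj v [:: e].

(** A path of [l] that starts at [v] with an edge f has its projection below s_f s_f^*, and this was
    subtracted in the cut. Only the paths of length 0 at [v] survive. *)
Lemma cut_proj_mul v l g : g \in l ->
  cut_proj v l ** proj g.2.1 g.2.2 =
  if (v == g.2.1) && nilp g.2.2 then cut_proj v l else 0.
Proof.
case: g => c [w es] gl; rewrite [(_, _).2.1]/= [(_, _).2.2]/=.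
rewrite csBmul (p_proj ck) csmul_suml.
have [<-|vw] := eqVneq v w; last first.
  by rewrite big1 ?subrr // => e _; rewrite (proj_mul ck) (negbTE vw).
rewrite andTb; case: es gl => [|f fs] gl.
  by congr (_ - _); apply: eq_bigr => e _; rewrite (proj_mul ck) eqxx.
have [fv|fv] := eqVneq (src f) v; last first.
  rewrite [proj v (f :: fs)]/= (negbTE fv) big1 ?subrr // => e _.
  by rewrite csmul0.
rewrite (eq_bigr (fun e => if f == e then proj v (f :: fs) else 0)); last first.
  move=> e _; rewrite (proj_mul ck) eqxx [meet _ _]/= [f == e]eq_sym.
  by case: eqP => // ->.
rewrite -big_mkcondr (eq_bigl (fun e => f == e)); last first.
  by move=> e; rewrite andbC; case: eqP => //= <-; rewrite fv eqxx.
rewrite big_pred1_uniq ?subrr //; first exact: undup_uniq.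
exact: (mem_heads gl).
Qed.

Lemma cut_proj_val v l : cut_proj v l ** comb_val l =
  cut_proj v l *~ \sum_(g <- l | (v == g.2.1) && nilp g.2.2) g.1.
Proof.
rewrite csmul_sumr [RHS]mulrz_sumr [RHS]big_mkcond; apply: eq_big_seq => g gl.
by rewrite csmulMz cut_proj_mul //; case: ifP => //; rewrite mul0rz.
Qed.

(** A singular [v] is itself such a boundary path. At a regular [v], the Cuntz-Krieger relation
    makes the cut vanish unless some edge outside [heads l] leaves [v], and then any boundary path
    through that edge will do. *)
Lemma cut_proj_nonzero v l : cut_proj v l <> 0 ->
  exists2 x, bsrc x = v & forall e, e \in heads l -> ~~ starts_with e x.
Proof.
move=> cn; have [rv|sv] := pselect (regular v); last first.
  have sv' : singular (frng (@FPath E v [::] isT)) by [].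
  by exists (BFin sv').
have [e [ev el]] : exists e, src e = v /\ e \notin heads l.
  apply: contrapT => none; apply: cn; rewrite /cut_proj.
  have all_heads e : src e = v -> e \in heads l.
    by move=> ev; apply/negPn/negP => el; apply: none; exists e.
  case: (ck) => _ _ _ _ /(_ v rv) ->.
  rewrite [X in _ - X](eq_bigr (fun e => s e ** (s e)^#)); last first.
    by move=> e /eqP <-; rewrite proj_edge.
  rewrite [X in _ - X]bigfs ?undup_uniq //; last first.
    by move=> e /eqP /all_heads ->.
  apply/eqP; rewrite subr_eq0; apply/eqP; apply: eq_fsbigl.
  by apply/seteqP; split=> e /eqP.
have [y yv] := bsrc_surj (rng e).
have [x ex _] := econs yv.
exists x; first by rewrite (starts_with_src ex).
by move=> f fl; apply/negP => /(starts_with_uniq ex) ef; rewrite ef fl in el.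
Qed.

Lemma ev_cut l x : (forall e, e \in heads l -> ~~ starts_with e x) ->
  ev l x = \sum_(g <- l | (bsrc x == g.2.1) && nilp g.2.2) g.1.
Proof.
move=> hx; rewrite /ev [RHS]big_mkcond; apply: eq_big_seq => -[c [v es]] gl.
case: es gl => [|e es] gl; first by rewrite /= andbT; case: eqP => _; rewrite ?mul1r ?mul0r.
by rewrite /= (negbTE (hx e (mem_heads gl erefl))) !andbF mul0r.
Qed.

(** Split p_v into the cut and the s_e s_e^* with e in [heads l]. The latter annihilate the value by
    hypothesis; on a nonzero cut the value is multiplication by an integer that [ev l] attains at a
    point, hence by 0. As every summand absorbs its vertex projection, the square of the value is
    0. *)
Lemma comb_val_eq0_step l : (forall x, ev l x = 0) ->
  (forall e, e \in heads l -> (s e)^# ** comb_val l ** s e = 0) -> comb_val l = 0.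
Proof.
move=> l0 se0.
have r0 e : e \in heads l -> proj (src e) [:: e] ** comb_val l = 0.
  move=> el; have {1}-> : proj (src e) [:: e] = proj (src e) [:: e] ** proj (src e) [:: e].
    by rewrite (proj_mul ck) !eqxx /= !eqxx /= eqxx.
  rewrite -cs_mulA (proj_val ck) proj_edge -[s e ** _ ** _]cs_mulA.
  by rewrite [_ ** (comb_val l ** _)]cs_mulA [_ ** (_ ** (s e)^#)]cs_mulA se0 // cs0mul csmul0.
have p0 v : p v ** comb_val l = 0.
  have -> : p v ** comb_val l = cut_proj v l ** comb_val l.
    rewrite csBmul csmul_suml big_seq_cond big1 ?subr0 // => e /andP[el /eqP <-].
    exact: r0.
  rewrite cut_proj_val; have [->|/eqP/cut_proj_nonzero[x <- hx]] := eqVneq (cut_proj v l) 0.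
    by rewrite mul0rz.
  by rewrite -ev_cut // l0 mulr0z.
apply: csmul_eq0; rewrite (comb_val_star ck) {1}/comb_val csmul_suml big1 // => g _.
have -> : proj g.2.1 g.2.2 = proj g.2.1 g.2.2 ** p g.2.1 by rewrite (proj_p ck) eqxx.
by rewrite csMzmul -cs_mulA p0 csmul0 mul0rz.
Qed.

(* Makes [step_val] well defined. Conjugating by [s_e] shortens the paths, and
   cutting off the first edges occurring in [l] leaves only its constant terms. *)
Lemma comb_val_eq0 l : (forall x, ev l x = 0) -> comb_val l = 0.
Proof.
have [n] : exists n, all (fun g => size g.2.2 <= n)%N l.
  exists (\max_(g <- l) size g.2.2)%N; apply/allP => g gl.
  exact: (@leq_bigmax_seq _ l xpredT (fun g => size g.2.2)).

elim: n l => [|n IH] l /allP ln l0; apply: comb_val_eq0_step => // e el.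
  move: el; rewrite mem_undup => /flattenP[_ /mapP[g /ln gl ->]].
  by move: gl; rewrite leqn0 => /nilP ->.
rewrite -(comb_val_pull ck); apply: IH.
  apply/allP => g /flattenP[_ /mapP[[c [v es]] /ln /= gl ->] /=].
  case: ifP => _ //; case: es gl => [|f fs] gl; first by rewrite inE => /eqP->.
  by case: ifP => _ //; rewrite inE => /eqP->.
move=> y; have [/econs[x ex <-]|ye] := eqVneq (bsrc y) (rng e).
  by rewrite ev_pull.
by rewrite ev_pull0.
Qed.

(** A representation is chosen, and [step_valE] shows that any other gives the same value, since
    their formal difference denotes 0. A function that is not a step function falls back on [[::]]
    and gets 0. *)
Definition step_val phi : A := comb_val (xget [::] [set l | phi =1 ev l]).

Lemma step_valE phi l : phi =1 ev l -> step_val phi = comb_val l.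
Proof.
move=> pl; have /= pl' : [set l | phi =1 ev l] (xget [::] [set l | phi =1 ev l]).
  by apply: xgetPex; exists l.
rewrite /step_val; move: (xget _ _) pl' => l' pl'.
apply/eqP; rewrite -subr_eq0 -[- comb_val l]mulrN1z -comb_val_zscale -comb_val_cat.
apply/eqP/comb_val_eq0 => x.
by rewrite ev_cat ev_zscale mulN1r -pl' pl subrr.
Qed.

Lemma eq_step_val phi psi : phi =1 psi -> step_val phi = step_val psi.
Proof. by move=> /funext ->. Qed.

Lemma step_valD phi psi : is_step phi -> is_step psi ->
  step_val (fun x => phi x + psi x) = step_val phi + step_val psi.
Proof.
move=> [l lE] [l' lE']; rewrite (step_valE lE) (step_valE lE') -comb_val_cat.
by apply: step_valE => x; rewrite ev_cat lE lE'.
Qed.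

Lemma step_valZ n phi : is_step phi -> step_val (fun x => n * phi x) = step_val phi *~ n.
Proof.
move=> [l lE]; rewrite (step_valE lE) -comb_val_zscale.
by apply: step_valE => x; rewrite ev_zscale lE.
Qed.

Lemma step_valM phi psi : is_step phi -> is_step psi ->
  step_val (fun x => phi x * psi x) = step_val phi ** step_val psi.
Proof.
move=> [l lE] [l' lE']; rewrite (step_valE lE) (step_valE lE') -comb_val_meets //.
by apply: step_valE => x; rewrite ev_meets lE lE'.
Qed.

Lemma step_val0 : step_val (fun=> 0) = 0.
Proof. by rewrite (@step_valE _ [::]) /comb_val ?big_nil // => x; rewrite /ev big_nil. Qed.

Lemma step_val_sum (I : Type) (r : seq I) (phi : I -> bpath E -> int) :
  (forall i, is_step (phi i)) ->
  step_val (fun x => \sum_(i <- r) phi i x) = \sum_(i <- r) step_val (phi i).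
Proof.
move=> H; elim: r => [|i r IH].
  by rewrite big_nil -step_val0; apply: eq_step_val => x; rewrite big_nil.
rewrite big_cons -IH -step_valD //; last exact: is_step_sum.
by apply: eq_step_val => x; rewrite big_cons.
Qed.

Lemma step_val_star phi : is_step phi -> (step_val phi)^# = step_val phi.
Proof. by move=> [l lE]; rewrite (step_valE lE) comb_val_star. Qed.

Definition set_proj U : A := step_val (ind U).

Lemma eq_set_proj U V : U =1 V -> set_proj U = set_proj V.
Proof. by move=> UV; apply: eq_step_val => x; rewrite /ind UV. Qed.

Lemma set_projI U V : is_clopen U -> is_clopen V ->
  set_proj U ** set_proj V = set_proj (fun x => U x && V x).
Proof.
move=> hU hV; rewrite -step_valM //; apply: eq_step_val => x.
by rewrite /ind -PoszM mulnb.
Qed.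

Lemma set_proj_star U : is_clopen U -> (set_proj U)^# = set_proj U.
Proof. exact: step_val_star. Qed.

Lemma set_proj0 : set_proj (fun=> false) = 0.
Proof. exact: step_val0. Qed.

Lemma set_proj_disjoint U V : is_clopen U -> is_clopen V ->
  (forall x, U x -> V x -> False) -> set_proj U ** set_proj V = 0.
Proof.
move=> hU hV UV; rewrite set_projI // -set_proj0; apply: eq_set_proj => x.
by apply/negP => /andP[/UV].
Qed.

Lemma set_proj_sum (I : Type) (r : seq I) U (V : I -> pred (bpath E)) :
  (forall i, is_clopen (V i)) ->
  (forall x, (U x)%:Z = \sum_(i <- r) (V i x)%:Z) ->
  set_proj U = \sum_(i <- r) set_proj (V i).
Proof. by move=> hV UV; rewrite -step_val_sum //; exact: eq_step_val. Qed.

Lemma set_proj_cyl v es : set_proj (cyl v es) = proj v es.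
Proof.
rewrite /set_proj (@step_valE _ [:: (1, (v, es))]); first by rewrite /comb_val big_seq1.
by move=> x; rewrite /ev big_seq1 /= mulr1.
Qed.

Lemma set_proj_starts e : set_proj (starts_with e) = s e ** (s e)^#.
Proof.
rewrite -proj_edge -set_proj_cyl; apply: eq_set_proj => x /=; rewrite eqxx /=.
by case: (boolP (starts_with e x)) => // /starts_with_shift ->; rewrite eqxx.
Qed.

Lemma set_proj_pull e U : is_clopen U ->
  (s e)^# ** set_proj U ** s e = set_proj (pullback e U).
Proof.
move=> [l lE]; rewrite {1}/set_proj (step_valE lE) -(comb_val_pull ck).
by apply/esym/step_valE; exact: ev_pullback.
Qed.

Lemma set_proj_push e U : is_clopen U ->
  s e ** set_proj U ** (s e)^# = set_proj (fun x => starts_with e x && U (shift x)).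
Proof.
move=> [l lE]; rewrite {1}/set_proj (step_valE lE) -(comb_val_push ck).
by apply/esym/step_valE => x; rewrite ev_push -lE /ind -PoszM mulnb.
Qed.

(** Insert s_e = s_e s_e^* s_e and commute the projection of [U] past s_e s_e^*, which is the
    projection of Z(e). *)
Lemma set_proj_s e U : is_clopen U -> set_proj U ** s e = s e ** set_proj (pullback e U).
Proof.
move=> hU; have se : s e = s e ** (s e)^# ** s e by case: (ck) => _ [/(_ e)].
rewrite -set_proj_pull // !cs_mulA [in LHS]se -set_proj_starts cs_mulA.
by rewrite !set_projI //; [congr (_ ** _); apply: eq_set_proj => x; rewrite andbC
  |exact: is_clopen_starts|exact: is_clopen_starts].
Qed.

End StepValues.

(** * Conjugacies and bisections *)

Section Conjugacy.
Variables (E F : digraph) (h : bpath E -> bpath F) (g : bpath F -> bpath E).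

(** The inverse is explicit, so that every construction can be repeated with [E] and [F]
    exchanged. *)
Definition conjugacy : Prop :=
  [/\ continuous h, continuous g, cancel h g, cancel g h &
      (forall x, blen_ge 1 x <-> blen_ge 1 (h x)) /\
      (forall x, blen_ge 1 x -> h (shift x) = shift (h x))].

Hypothesis hg : conjugacy.

Lemma conjugacy_len1 y : blen_ge 1 y <-> blen_ge 1 (g y).
Proof. by case: hg => _ _ _ gK [hl _]; rewrite hl gK. Qed.

Lemma conjugacy_shift y : blen_ge 1 y -> g (shift y) = shift (g y).
Proof.
move=> yl; case: hg => _ _ hK gK [_ hs].
by rewrite -{1}(gK y) -hs ?hK //; exact/conjugacy_len1.
Qed.

End Conjugacy.

Lemma conjugacy_sym (E F : digraph) (h : bpath E -> bpath F) (g : bpath F -> bpath E) :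
  conjugacy h g -> conjugacy g h.
Proof.
move=> hg; have [hc gc hK gK _] := hg; split=> //; split.
  exact: (conjugacy_len1 hg).
exact: (conjugacy_shift hg).
Qed.

Lemma conjugateP (E F : digraph) : conjugate E F -> exists h g, @conjugacy E F h g.
Proof.
move=> [h [[hc [g [gc hK gK]]] hl hs]]; exists h, g; split=> //; split=> // x.
split=> [xl|]; first by rewrite -hl; exists x.
by rewrite -hl => -[x' xl' /(can_inj hK) <-].
Qed.

Section Clopen.
Variable E : digraph.

Lemma Zminus_open (mu : fpath E) (K : set (edge E)) :
  finite_set K -> K `<=` out (frng mu) -> open (Zminus mu K).
Proof. by move=> fK KO; apply/bpath_openP => x Zx; exists mu, K; split. Qed.

Lemma Zminus_clopen (mu : fpath E) (K : set (edge E)) :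
  finite_set K -> K `<=` out (frng mu) ->
  exists2 V, is_clopen V & forall x, V x <-> Zminus mu K x.
Proof.
move=> /finite_seqP[r ->] KO.
pose ext e := cyl (fsrc mu) (fedges mu ++ [:: e]).
exists (fun x => cyl (fsrc mu) (fedges mu) x && ~~ has (ext^~ x) r).
  apply: is_clopenD (is_clopen_cyl _ _) _.
  elim: r {KO} => [|e r IH]; first exact: is_clopen0.
  exact: is_clopenU (is_clopen_cyl _ _) IH.
move=> x; split.
  move=> /andP[/Z_cyl Zx /hasPn nx]; split=> // -[e /nx ne [he /Z_cyl Ze]].
  by rewrite /ext Ze in ne.
move=> [/Z_cyl -> nx]; apply/hasPn => e er; apply/negP => xe; apply: nx.
exists e => //; exists (KO _ er); exact/Z_cyl.
Qed.

Lemma sum_starts_with (K : seq (edge E)) (x : bpath E) :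
  uniq K -> has (fun f => starts_with f x) K ->
  \sum_(e <- K) (starts_with e x)%:Z = 1.
Proof.
move=> uK /hasP[e eK ex]; rewrite (bigD1_seq e) //= ex big1 ?addr0 // => f fe.
by have [/(starts_with_uniq ex) ef|//] := boolP (starts_with f x); rewrite ef eqxx in fe.
Qed.

(** A boundary path of length 0 is a singular vertex. *)
Lemma starts_with_regular (x : bpath E) : regular (bsrc x) -> exists e, starts_with e x.
Proof.
move=> rx; apply: starts_with_exists; case: x rx => // mu s rx /=.
rewrite lt0n; apply/negP => /nilP mu0; apply: (s).
by rewrite /frng mu0.
Qed.

End Clopen.

Section ConjugacyClopen.
Variables (E F : digraph) (h : bpath E -> bpath F) (g : bpath F -> bpath E).
Hypothesis hg : conjugacy h g.

Lemma is_clopen_conj_Z (mu : fpath E) :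
  is_clopen (fun y => cyl (fsrc mu) (fedges mu) (g y)).
Proof.
have [hc gc hK gK _] := hg.
(* [Q W]: some clopen [V] lies between h(W), for the part of [W] in [Z mu], and h(Z mu). Locally [V]
   is a basic set given by continuity of [g]; for [W := Z mu] both bounds coincide. *)
pose Q (W : set (bpath E)) := exists V : pred (bpath F), [/\ is_clopen V,
  forall x, W x -> Z mu x -> V (h x) & forall y, V y -> Z mu (g y)].
have [] : Q (Z mu).
  apply: Z_compact_ind.
  - by move=> U V UV [S [cS VS SZ]]; exists S; split=> // x /UV /VS.
  - move=> U V [S [cS US SZ]] [S' [cS' VS' S'Z]].
    exists (fun y => S y || S' y); split; first exact: is_clopenU.
      by move=> x [/US H /H ->//|/VS' H /H ->]; rewrite orbT.
    by move=> y /orP[/SZ|/S'Z].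
  move=> x Zx.
  have oZ : open (g @^-1` Z mu) by move/continuousP: gc; apply; exact: Z_open.
  have Zhx : (g @^-1` Z mu) (h x) by rewrite /= hK.
  have /bpath_openP/(_ _ Zhx)[nu [K [fK KO nx nZ]]] := oZ.
  exists (h @^-1` Zminus nu K); split=> //.
    by move/continuousP: hc; apply; exact: Zminus_open.
  have [V cV VE] := Zminus_clopen fK KO.
  by exists V; split=> // [x' /VE//|y /VE /nZ].
move=> V [cV ZV VZ]; apply: eq_is_step cV => y; rewrite /ind; congr Posz.
congr nat_of_bool; apply/idP/idP => [/VZ/Z_cyl//|/Z_cyl Zy].
by have := ZV _ Zy Zy; rewrite gK.
Qed.

Lemma is_clopen_conj_cyl v es : is_clopen (fun y => cyl v es (g y)).
Proof.
have [c|nc] := boolP (chain v es); first exact: (is_clopen_conj_Z (FPath c)).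
apply: eq_is_step (@is_clopen0 F) => y; rewrite /ind; case: cyl (cylP v es (g y)) => //.
by move=> [/(_ isT)[c]]; rewrite c in nc.
Qed.

Lemma is_step_conj phi : is_step phi -> is_step (fun y => phi (g y)).
Proof.
move=> [l lE]; apply: (@eq_is_step _ (fun y => ev l (g y))) => [y|]; first by rewrite lE.
apply: is_step_sum => -[c [v es]] /=.
apply: eq_is_step (is_stepZ c (is_clopen_conj_cyl v es)) => y.
by rewrite mulrC.
Qed.

(** By compactness of Z(e), its image under [h] meets finitely many Z(f). The list [K] may contain
    further edges; it makes the sum that defines the transported isometry finite. *)
Lemma edge_cover e : exists K : seq (edge F), uniq K /\
  forall y, starts_with e (g y) -> has (fun f => starts_with f y) K.
Proof.
have [hc gc hK gK [hl _]] := hg.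
pose Q (W : set (bpath E)) := exists K : seq (edge F),
  forall x, W x -> starts_with e x -> has (fun f => starts_with f (h x)) K.
have [K KP] : Q (Z (fedge e)).
  apply: Z_compact_ind.
  - by move=> U V UV [K KP]; exists K => x /UV /KP.
  - move=> U V [K KP] [K' KP']; exists (K ++ K') => x UVx ex; rewrite has_cat.
    by case: UVx => [/KP/(_ ex)->//|/KP'/(_ ex)->]; rewrite orbT.
  move=> x /starts_with_Z/starts_with_len/hl/starts_with_exists[f fx].
  exists (h @^-1` Z (fedge f)); split.
  - by move/continuousP: hc; apply; exact: Z_open.
  - exact/starts_with_Z.
  by exists [:: f] => x' /starts_with_Z fx' _; rewrite /= fx'.
exists (undup K); rewrite undup_uniq; split=> // y ey.
have /hasP[f fK fy] := KP _ ((starts_with_Z _ _).1 ey) ey.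
by apply/hasP; exists f; rewrite ?mem_undup // -{1}(gK y).
Qed.

End ConjugacyClopen.

Section Bisection.
Variables (R : realType) (B : cstar_algebra R) (F : digraph).
Variables (q : vert F -> B) (t : edge F -> B).
Hypothesis ck : ck_family q t.
Variables (U : pred (bpath F)) (K : seq (edge F)).
Hypotheses (cU : is_clopen U) (uK : uniq K).
Hypothesis UK : forall y, U y -> has (fun f => starts_with f y) K.
Hypothesis Uinj : forall y y', U y -> U y' -> shift y = shift y' -> y = y'.
Local Notation P := (set_proj q t).

(* The partial isometry of the bisection [(y, 1, shift y)], [y \in U]. *)
Definition bisection_isometry (U : pred (bpath F)) (K : seq (edge F)) : B :=
  \sum_(f <- K) P U ** t f.
Local Notation T := (bisection_isometry U K).

Definition shift_image : pred (bpath F) := fun z => `[< exists2 y, U y & shift y = z >].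

Lemma pullback_disjoint f f' z :
  f != f' -> pullback f U z -> pullback f' U z -> False.
Proof.
move=> /eqP ff' /asboolP[y [fy Uy <-]] /asboolP[y' [fy' Uy' yy']]; apply: ff'.
have yE := Uinj Uy' Uy yy'; rewrite yE in fy'; exact: starts_with_uniq fy fy'.
Qed.

(** The shift is injective on [U], so the images of the pieces of [U] in Z(f), for f in [K],
    partition the image of [U]. *)
Lemma ind_shift_image z :
  (shift_image z)%:Z = \sum_(f <- K) (pullback f U z)%:Z.
Proof.
have [/asboolP[y Uy <-]|nz] := boolP (shift_image z); last first.
  rewrite big1 // => f _; case: (boolP (pullback f U z)) => // /asboolP[y [_ Uy yz]].
  by case/asboolP: nz; exists y.
rewrite -[LHS]/(1 : int) -(sum_starts_with uK (UK Uy)); apply: eq_bigr => f _.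
have [/pullback_shift -> //|nf] := boolP (starts_with f y); first by rewrite Uy.
case: (boolP (pullback f U (shift y))) => // /asboolP[y' [fy' Uy' yy']].
by rewrite -(Uinj Uy' Uy yy') fy' in nf.
Qed.

Lemma is_clopen_shift_image : is_clopen shift_image.
Proof.
apply: eq_is_step (is_step_sum K (fun f => is_clopen_pullback f cU)) => z.
by rewrite /ind ind_shift_image.
Qed.

Lemma set_proj_isometry : P U ** T = T.
Proof.
rewrite csmul_sumr; apply: eq_bigr => f _; rewrite cs_mulA set_projI //.
by congr (_ ** _); apply: eq_set_proj => y; rewrite andbb.
Qed.

Lemma isometry_shift_image : T ** P shift_image = T.
Proof.
rewrite csmul_suml; apply: eq_bigr => f _.
rewrite (set_proj_s ck) // -cs_mulA set_projI //; last 2 first.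
- exact: is_clopen_pullback.
- exact: is_clopen_shift_image.
congr (_ ** _); apply: eq_set_proj => z; apply/andP/idP => [[]//|pz]; split=> //.
by apply/asboolP; case/asboolP: pz => y [_ Uy yz]; exists y.
Qed.

(** The cross terms for f and f' contain the product of the projections of two disjoint sets
    [pullback f U] and [pullback f' U]. The diagonal terms give the pieces in Z(f), which add up
    since [K] covers [U]. *)
Lemma isometry_conj W : is_clopen W ->
  T ** P W ** T^# = P (fun y => U y && W (shift y)).
Proof.
move=> cW; pose V f y := U y && (starts_with f y && W (shift y)).
have cV f : is_clopen (V f) by apply: is_clopenI => //; exact: is_clopen_push.
rewrite csmul_suml csmul_suml (@set_proj_sum _ _ _ _ _ ck _ K
  (fun y => U y && W (shift y)) V) //; last first.
  move=> y; rewrite /V; case: (boolP (U y)) => Uy /=; last by rewrite big1.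
  case: (W (shift y)); last by rewrite big1 // => f _; rewrite andbF.
  by rewrite -[LHS]/(1 : int) -(sum_starts_with uK (UK Uy)); apply: eq_bigr => f _; rewrite andbT.
apply: eq_big_seq => f fK.
rewrite csstar_sum csmul_sumr (bigD1_seq f) //= big1 ?addr0 => [|f' f'f].
  rewrite cs_starM (set_proj_star ck) // !cs_mulA.
  rewrite -[P U ** t f ** P W]cs_mulA -[P U ** _ ** (t f)^#]cs_mulA (set_proj_push ck) //.
  have cp := is_clopen_push f cW.
  rewrite (set_projI ck cU cp) (set_projI ck (is_clopenI cU cp) cU).
  by apply: eq_set_proj => y; rewrite /V; case: (U y); rewrite ?andbF ?andbT.
rewrite !(set_proj_s ck) // cs_starM (set_proj_star ck); last exact: is_clopen_pullback.
rewrite !cs_mulA -[t f ** P _ ** P W]cs_mulA -[t f ** _ ** P _]cs_mulA.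
have cp e := is_clopen_pullback e cU.
rewrite (set_projI ck (cp f) cW) (set_projI ck (is_clopenI (cp f) cW) (cp f')).
rewrite (@eq_set_proj _ _ _ _ _ _ (fun=> false)) ?(set_proj0 ck) ?csmul0 ?cs0mul // => z.
by apply/negP => /andP[/andP[pf _]]; apply: pullback_disjoint pf; rewrite eq_sym.
Qed.

(** With no unit at hand, [isometry_conj] is applied to [shift_image], whose projection is a right
    unit for the isometry. *)
Lemma isometry_range : T ** T^# = P U.
Proof.
rewrite -{1}isometry_shift_image (isometry_conj is_clopen_shift_image).
apply: eq_set_proj => y; apply/andP/idP => [[]//|Uy]; split=> //.
by apply/asboolP; exists y.
Qed.

(** Moving the projection of [U] to the right leaves t_f^* t_f' in front, so here the cross terms
    vanish by orthogonality of ranges. *)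
Lemma isometry_source : T^# ** T = P shift_image.
Proof.
rewrite (@set_proj_sum _ _ _ _ _ ck _ K shift_image (fun f => pullback f U)); last 2 first.
- by move=> f; exact: is_clopen_pullback.
- exact: ind_shift_image.
rewrite csstar_sum csmul_suml; apply: eq_big_seq => f fK.
have TE f' : (P U ** t f)^# ** (P U ** t f') = (t f)^# ** t f' ** P (pullback f' U).
  rewrite cs_starM (set_proj_star ck) // -cs_mulA [P U ** _]cs_mulA (set_projI ck) //.
  rewrite (@eq_set_proj _ _ _ _ _ (fun x => U x && U x) U); last by move=> y; rewrite andbb.
  by rewrite (set_proj_s ck) // cs_mulA.
rewrite csmul_sumr (bigD1_seq f) //= big1 ?addr0 => [|f' f'f].
  rewrite cs_starM (set_proj_star ck) // -cs_mulA [P U ** _]cs_mulA (set_projI ck) //.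
  rewrite (@eq_set_proj _ _ _ _ _ (fun x => U x && U x) U); last by move=> y; rewrite andbb.
  by rewrite cs_mulA (set_proj_pull ck).
by rewrite TE (ck_ss ck) eq_sym (negbTE f'f) cs0mul.
Qed.

End Bisection.

(** * The transported Cuntz-Krieger family *)

Section Transport.
Variables (R : realType) (A B : cstar_algebra R) (E F : digraph).
Variables (p : vert E -> A) (s : edge E -> A) (q : vert F -> B) (t : edge F -> B).
Hypotheses (ckp : ck_family p s) (ckq : ck_family q t).
Variables (h : bpath E -> bpath F) (g : bpath F -> bpath E) (K : edge E -> seq (edge F)).
Hypothesis hg : conjugacy h g.
Hypothesis uK : forall e, uniq (K e).
Hypothesis KP : forall e y, starts_with e (g y) -> has (fun f => starts_with f y) (K e).
Local Notation P := (set_proj q t).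

Let start e : pred (bpath F) := fun y => starts_with e (g y).

Definition transport_p v : B := P (fun y => cyl v [::] (g y)).
Definition transport_s e : B := bisection_isometry q t (start e) (K e).

Let cstart e : is_clopen (start e).
Proof. exact: is_step_conj hg _ (is_clopen_starts e). Qed.

Let start_inj e y y' : start e y -> start e y' -> shift y = shift y' -> y = y'.
Proof.
have [_ _ _ gK _] := hg; move=> ey ey' yy'; apply: (can_inj gK).
apply: (starts_with_inj ey ey').
have len z : start e z -> blen_ge 1 z by move=> /starts_with_len /(conjugacy_len1 hg).
by rewrite -!(conjugacy_shift hg) ?yy' //; exact: len.
Qed.

Let start_shift e y : start e y -> g (shift y) = shift (g y).
Proof.
by move=> ey; rewrite (conjugacy_shift hg) //; apply/(conjugacy_len1 hg); exact: starts_with_len ey.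
Qed.

(** Underlies s_e^* s_e = p_(r(e)) for the transported family: [h] intertwines the shifts, and every
    boundary path with source [rng e] can be preceded by e. *)
Lemma start_shift_image e z : shift_image (start e) z = (bsrc (g z) == rng e).
Proof.
have [hc gc hK gK [hl hs]] := hg.
apply/asboolP/eqP => [[y ey <-]|/econs[x ex xz]].
  by rewrite (start_shift ey); exact: starts_with_shift.
exists (h x); first by rewrite /start hK.
by rewrite -hs ?xz ?gK //; exact: starts_with_len ex.
Qed.

Lemma transport_ck : ck_family transport_p transport_s.
Proof.
have cv v := is_clopen_conj_cyl hg v [::].
have TT e : transport_s e ** (transport_s e)^# = P (start e).
  exact: (isometry_range ckq (cstart e) (uK e) (@KP e) (@start_inj e)).
have PT e : P (start e) ** transport_s e = transport_s e.
  exact: (set_proj_isometry ckq (K e) (cstart e)).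
split.
- split=> [v|v w vw]; first split.
  + rewrite (set_projI ckq) //; apply: eq_set_proj => y; exact: andbb.
  + exact: set_proj_star.
  + apply: (set_proj_disjoint ckq) => // y /cyl_src yv /cyl_src yw.
    by apply: vw; rewrite -yv -yw.
- split=> [e|e f ef]; first by rewrite /partial_isometry TT PT.
  rewrite -(PT e) -(PT f) cs_starM (set_proj_star ckq) // cs_mulA.
  rewrite -[_ ** P _ ** P _]cs_mulA (set_proj_disjoint ckq) ?csmul0 ?cs0mul // => y ye yf.
  by apply: ef; exact: starts_with_uniq ye yf.
- move=> e; rewrite (isometry_source ckq (cstart e) (uK e) (@KP e) (@start_inj e)).
  by apply: eq_set_proj => z; rewrite start_shift_image.
- move=> e; rewrite /proj_le TT !(set_projI ckq) //.
  by split; apply: eq_set_proj => y /=; case: (boolP (start e y)) => [/starts_with_src ->|];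
    rewrite ?eqxx ?andbF.
(* At a regular [v] every boundary path has a first edge, so Z(v) is the finite disjoint union of
   the Z(e). The sum over [out v] is first turned into a sum over a duplicate-free list. *)
move=> v rv; have [fin _] := rv; have /finite_seqP[r rE] := fin.
have mem_r e : (e \in undup r) = (src e == v).
  rewrite mem_undup; apply/idP/eqP => [er|ev].
    by have : out v e by rewrite rE.
  by have : out v e by []; rewrite rE.
rewrite (_ : out v = [set` undup r]); last first.
  by apply/seteqP; split=> e /=; rewrite mem_r => /eqP.
rewrite -fsbig_seq ?undup_uniq //.
under eq_bigr => e _ do rewrite TT.
apply: (set_proj_sum ckq) => // y /=.
have [yv|yv] := eqVneq (bsrc (g y)) v; last first.
  rewrite big_seq big1 // => e; rewrite mem_r => /eqP ev.
  rewrite /start; case: (boolP (starts_with e (g y))) => // /starts_with_src yv'.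
  by rewrite yv' ev eqxx in yv.
rewrite sum_starts_with ?undup_uniq //; apply/hasP.
have [|e ey] := @starts_with_regular _ (g y); first by rewrite yv.
by exists e => //; rewrite mem_r -(starts_with_src ey) yv.
Qed.

Variable Phi : A -> B.
Hypothesis PhiH : star_hom Phi.
Hypothesis Phi_p : forall v, Phi (p v) = transport_p v.
Hypothesis Phi_s : forall e, Phi (s e) = transport_s e.

(** By induction on the path: conjugation by the image of s_e restricts to h(Z(e)) and composes with
    the shift, with which [g] commutes there. *)
Lemma star_hom_proj v es : Phi (proj p s v es) = P (fun y => cyl v es (g y)).
Proof.
have [_ _ PhiM PhiS] := PhiH.
elim: es v => [|e es IH] v; first exact: Phi_p.
rewrite [proj _ _ _ _]/=; have [ev|ev] := eqVneq (src e) v; last first.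
  rewrite (star_hom0 PhiH) -(set_proj0 ckq); apply: eq_set_proj => y /=.
  by rewrite (negbTE ev).
rewrite !PhiM PhiS IH Phi_s.
rewrite (isometry_conj ckq (cstart e) (uK e) (@KP e) (@start_inj e)); last first.
  exact: (is_clopen_conj_cyl hg).
apply: eq_set_proj => y /=; rewrite ev eqxx /=.
rewrite -[starts_with e (g y)]/(start e y).
by have [ey|//] := boolP (start e y); rewrite (start_shift ey).
Qed.

Lemma star_hom_step phi : is_step phi ->
  Phi (step_val p s phi) = step_val q t (fun y => phi (g y)).
Proof.
move=> [l lE]; rewrite (step_valE ckp lE).
rewrite (@eq_step_val _ _ _ _ _ _ (fun y => \sum_(i <- l) i.1 * (cyl i.2.1 i.2.2 (g y))%:Z));
  last first.
  by move=> y; rewrite lE; apply: eq_bigr => i _; rewrite mulrC.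
rewrite (step_val_sum ckq) => [|i]; last by apply: is_stepZ; exact: (is_clopen_conj_cyl hg).
pose PhiA := GRing.isZmodMorphism.Build A B Phi (star_hom_is_zmod PhiH).
pose PhiL : {additive A -> B} := HB.pack Phi PhiA.
rewrite -[Phi]/(PhiL : A -> B) raddf_sum; apply: eq_bigr => i _.
rewrite raddfMz /= star_hom_proj (step_valZ ckq) //; exact: (is_clopen_conj_cyl hg).
Qed.

End Transport.

(** * Linear spans and the diagonal subalgebra *)

Section Span.
Variables (R : realType) (A : cstar_algebra R) (X : set A).

Lemma linear_span0 : linear_span X 0.
Proof.
exists 0%N, (fun=> 0), (fun=> 0); split; first by case.
by rewrite big_ord0.
Qed.

Lemma linear_spanD a b : linear_span X a -> linear_span X b -> linear_span X (a + b).
Proof.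
move=> [m [c [x [xX ->]]]] [n [d [y [yX ->]]]].
exists (m + n)%N, (fun i => match fintype.split i with inl j => c j | inr j => d j end),
  (fun i => match fintype.split i with inl j => x j | inr j => y j end); split.
  by move=> i; case: fintype.split.
rewrite big_split_ord; congr (_ + _); apply: eq_bigr => i _ /=.
  by rewrite -[lshift n i]/(unsplit (inl i)) unsplitK.
by rewrite -[rshift m i]/(unsplit (inr i)) unsplitK.
Qed.

Lemma linear_spanZ (k : R[i]) a : linear_span X a -> linear_span X (k *: a).
Proof.
move=> [n [c [x [xX ->]]]]; exists n, (fun i => k * c i), x; split=> //.
by rewrite scaler_sumr; apply: eq_bigr => i _; rewrite scalerA.
Qed.

Lemma linear_span_gen a : X a -> linear_span X a.
Proof. by move=> Xa; exists 1%N, (fun=> 1), (fun=> a); rewrite big_ord1 scale1r. Qed.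

Lemma linear_span_sum (n : nat) (x : 'I_n -> A) :
  (forall i, linear_span X (x i)) -> linear_span X (\sum_(i < n) x i).
Proof.
move=> H; elim/big_ind: _ => // [|a b]; [exact: linear_span0|exact: linear_spanD].
Qed.

End Span.

Section Diagonal.
Variables (R : realType) (A : cstar_algebra R) (E : digraph).
Variables (p : vert E -> A) (s : edge E -> A).
Hypothesis ck : ck_family p s.
Local Notation gens := [set s_path p s mu ** (s_path p s mu)^# | mu in [set: fpath E]].

Lemma s_path_proj (mu : fpath E) :
  s_path p s mu ** (s_path p s mu)^# = proj p s (fsrc mu) (fedges mu).
Proof.
case: mu => v es c; rewrite /s_path /=.
case: es c => [|e es] /= c; first by rewrite (ck_pS ck) (ck_pp ck) eqxx.
case/andP: c => -> c.
(* [s_path] is a left fold, so the induction runs over an arbitrary accumulated prefix a with a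
   p_(r(e)) = a in place of s_e. *)
elim: es e (s e) (ck_sp ck e) c => [|f es IH] e a ae /= c.
  by rewrite ae.
case/andP: (c) => /eqP fe c'.
rewrite fe eqxx (IH f) //; last by rewrite -cs_mulA (ck_sp ck).
by rewrite cs_starM !cs_mulA.
Qed.

Lemma proj_span v es : linear_span gens (proj p s v es).
Proof.
have [c|nc] := boolP (chain v es).
  by apply: linear_span_gen; exists (FPath c) => //; exact: s_path_proj.
suff -> : proj p s v es = 0 by exact: linear_span0.
elim: es v nc => //= e es IH v.
by case: eqP => //= _ /IH ->; rewrite csmul0 cs0mul.
Qed.

Lemma step_val_span phi : is_step phi -> linear_span gens (step_val p s phi).
Proof.
move=> [l lE]; rewrite (step_valE ck lE) /comb_val; elim: l {lE} => [|i l IH].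
  by rewrite big_nil; exact: linear_span0.
rewrite big_cons; apply: linear_spanD => //; rewrite -scaler_int.
by apply: linear_spanZ; exact: proj_span.
Qed.

End Diagonal.

Section DiagonalImage.
Variables (R : realType) (A B : cstar_algebra R) (Phi : A -> B).
Hypothesis PhiH : star_hom Phi.

Lemma star_hom_sum (n : nat) (x : 'I_n -> A) : Phi (\sum_(i < n) x i) = \sum_(i < n) Phi (x i).
Proof.
have [PhiD _ _ _] := PhiH.
by elim/big_rec2: _ => [|i a b _ <-]; [exact: star_hom0|rewrite PhiD].
Qed.

Lemma star_hom_closure_span (X : set A) (Y : set B) :
  (forall a, X a -> linear_span Y (Phi a)) ->
  forall a, closure (linear_span X) a -> closure (linear_span Y) (Phi a).
Proof.
move=> XY a aX V nV; have [b [[n [c [x [xX bE]]]] Vb]] := aX _ (star_hom_continuous PhiH nV).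
exists (Phi b); split=> //; rewrite bE star_hom_sum; apply: linear_span_sum => i.
by have [_ PhiZ _ _] := PhiH; rewrite PhiZ; apply: linear_spanZ; exact: XY.
Qed.

End DiagonalImage.

(** * The two transported homomorphisms are mutually inverse *)

Section Inverse.
Variables (R : realType) (A B : cstar_algebra R) (E F : digraph).
Variables (p : vert E -> A) (s : edge E -> A) (q : vert F -> B) (t : edge F -> B).
Hypotheses (gp : is_graph_algebra p s) (ckq : ck_family q t).
Variables (h : bpath E -> bpath F) (g : bpath F -> bpath E).
Hypothesis hg : conjugacy h g.
Variables (K : edge E -> seq (edge F)) (L : edge F -> seq (edge E)).
Hypothesis uK : forall e, uniq (K e).
Hypothesis KP : forall e y, starts_with e (g y) -> has (fun f => starts_with f y) (K e).
Hypothesis uL : forall f, uniq (L f).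
Hypothesis LP : forall f x, starts_with f (h x) -> has (fun e => starts_with e x) (L f).
Variables (Phi : A -> B) (Psi : B -> A).
Hypotheses (PhiH : star_hom Phi) (PsiH : star_hom Psi).
Hypothesis Phi_p : forall v, Phi (p v) = transport_p q t g v.
Hypothesis Phi_s : forall e, Phi (s e) = transport_s q t g K e.
Hypothesis Psi_p : forall w, Psi (q w) = transport_p p s h w.
Hypothesis Psi_s : forall f, Psi (t f) = transport_s p s h L f.

Let ckp : ck_family p s. Proof. by case: gp. Qed.
Let gh : conjugacy g h := conjugacy_sym hg.
Let hK : cancel h g. Proof. by case: hg. Qed.
Local Notation P := (set_proj p s).

Lemma Psi_set_proj U : is_clopen U -> Psi (set_proj q t U) = P (fun x => U (h x)).
Proof. exact: (star_hom_step ckq ckp gh uL LP PsiH Psi_p Psi_s). Qed.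

Lemma PsiPhi_p v : Psi (Phi (p v)) = p v.
Proof.
rewrite Phi_p Psi_set_proj; last exact: (is_clopen_conj_cyl hg).
rewrite -[RHS]/(proj p s v [::]) -(set_proj_cyl ckp).
by apply: eq_set_proj => x; rewrite hK.
Qed.

(** [Psi (t f)] is a sum of terms ending in s_e', and the projection of Z(e) on the left kills those
    with e' different from e. What remains is s_e cut down to the part of Z(e) that [h] sends into
    Z(f); the sum over f in [K e] restores s_e. *)
Lemma PsiPhi_s e : Psi (Phi (s e)) = s e.
Proof.
have [_ _ PsiM _] := PsiH.
have ce : is_clopen (starts_with e) := is_clopen_starts e.
have cf f : is_clopen (fun x => starts_with f (h x)).
  exact: is_step_conj gh _ (is_clopen_starts f).
have inner f : Psi (set_proj q t (fun y => starts_with e (g y)) ** t f) =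
    P (fun x => starts_with e x && starts_with f (h x)) ** s e.
  rewrite PsiM Psi_s Psi_set_proj; last exact: is_step_conj hg _ ce.
  rewrite (@eq_set_proj _ _ _ _ _ _ (starts_with e)) => [|x]; last by rewrite hK.
  rewrite csmul_sumr.
  have mv e' : P (starts_with e) ** (P (fun x => starts_with f (h x)) ** s e') =
      if e == e' then P (fun x => starts_with e x && starts_with f (h x)) ** s e else 0.
    rewrite cs_mulA (set_projI ckp) //.
    rewrite (@eq_set_proj _ _ _ _ _ _ (fun x => starts_with f (h x) && starts_with e x));
      last by move=> x; rewrite andbC.
    rewrite -(set_projI ckp) // -cs_mulA (set_proj_starts ckp) -cs_mulA (ck_ss ckp).
    case: eqP => [ee|_]; last by rewrite !csmul0.
    by rewrite -!cs_mulA (ck_ss ckp) eqxx.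
  rewrite (eq_bigr _ (fun e' _ => mv e')) -big_mkcond /=.
  (* If e is not in [L f], the sum is empty, and on the other side no path in Z(e) is sent into
     Z(f), so both are 0. *)
  have [eL|eL] := boolP (e \in L f); first by rewrite big_pred1_uniq.
  rewrite big_seq_cond big1 => [|e' /andP[e'L /eqP ee']]; last by rewrite ee' e'L in eL.
  rewrite (@eq_set_proj _ _ _ _ _ _ (fun=> false)) ?(set_proj0 ckp) ?cs0mul // => x.
  apply/negP => /andP[ex /LP/hasP[e' e'L /(starts_with_uniq ex) ee']].
  by rewrite ee' e'L in eL.
rewrite Phi_s /transport_s /bisection_isometry.
pose PsiA := GRing.isZmodMorphism.Build B A Psi (star_hom_is_zmod PsiH).
pose PsiL : {additive B -> A} := HB.pack Psi PsiA.
rewrite -[Psi]/(PsiL : B -> A) raddf_sum.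
rewrite (eq_bigr _ (fun f _ => inner f)) -csmul_suml.
have <- : P (starts_with e) =
    \sum_(f <- K e) P (fun x => starts_with e x && starts_with f (h x)).
  apply: (set_proj_sum ckp) => [f|x]; first exact: is_clopenI.
  have [ex|_] := boolP (starts_with e x); last by rewrite big1.
  by rewrite -[LHS]/(1 : int) -(sum_starts_with (uK e) (KP (y := h x) _)) ?hK.
rewrite (set_proj_starts ckp); by case: (ckp) => _ [pi _] _ _ _; exact: pi.
Qed.

(** The fixed points of the composite form a *-subalgebra containing the generators, and it is
    closed by automatic continuity. *)
Lemma PsiPhiK : cancel Phi Psi.
Proof.
have [PhiD PhiZ PhiM PhiS] := PhiH; have [PsiD PsiZ PsiM PsiS] := PsiH.
move=> a; suff : [set a | Psi (Phi a) = a] = setT by move/seteqP => [_ /(_ a)]; apply.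
case: gp => _ gen _; apply: gen PsiPhi_p PsiPhi_s; split.
- have -> : [set a | Psi (Phi a) = a] = (fun a => Psi (Phi a) - a) @^-1` [set 0].
    by apply/seteqP; split=> b /= => [->|/subr0_eq]; rewrite ?subrr.
  have /continuous_closedP : continuous (fun a => Psi (Phi a) - a).
    move=> b; apply: cvgB; last exact: cvg_id.
    by apply: (@continuous_comp _ _ _ Phi Psi); exact: star_hom_continuous.
  by apply; apply: accessible_closed_set1; exact: hausdorff_accessible (@norm_hausdorff _ _).
- by rewrite /= (star_hom0 PhiH) (star_hom0 PsiH).
- by move=> b c /= hb hc; rewrite PhiD PsiD hb hc.
- by move=> k b /= hb; rewrite PhiZ PsiZ hb.
- by split=> [b c|b] /=; [move=> hb hc; rewrite PhiM PsiM hb hc|move=> hb; rewrite PhiS PsiS hb].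
Qed.

Lemma Phi_diagonal a : graph_diagonal p s a -> graph_diagonal q t (Phi a).
Proof.
apply: (star_hom_closure_span PhiH) => _ [mu _ <-].
rewrite (s_path_proj ckp) (star_hom_proj ckq hg uK KP PhiH Phi_p Phi_s).
by apply: (step_val_span ckq); exact: (is_clopen_conj_cyl hg).
Qed.

End Inverse.

(** * The isomorphism of graph groupoids *)

Section GroupoidMap.
Variables (E F : digraph) (h : bpath E -> bpath F) (g : bpath F -> bpath E).
Hypothesis hg : conjugacy h g.

(** A conjugacy is only required to respect length at least 1. Length at least [m] must be carried
    through the same induction, because the intertwining relation is guarded by it. *)
Lemma conjugacy_iter m x : blen_ge m x ->
  blen_ge m (h x) /\ h (iter m (@shift E) x) = iter m (@shift F) (h x).
Proof.
have [_ _ _ _ [hl hs]] := hg.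
elim: m x => [|m IH] x xl; first by split=> //; case: (h x).
have xl1 : blen_ge 1 x by case: x xl => //= mu _; exact: leq_trans.
have [|hl' hs'] := IH (shift x).
  by apply: (@blen_ge_iter _ 1 m x); rewrite addn1.
split; last by rewrite !iterSr hs' hs.
rewrite -addn1; apply: blen_ge_add; first exact/hl.
by rewrite /= -hs.
Qed.

Lemma in_gpd_conj x k y : in_gpd x k y -> in_gpd (h x) k (h y).
Proof.
move=> [m [n [lx ly kE e]]]; exists m, n.
have [lhx ex] := conjugacy_iter lx; have [lhy ey] := conjugacy_iter ly.
by split; rewrite // -ex -ey e.
Qed.

Definition gpd_map (a : gpd E) : gpd F := Gpd (in_gpd_conj (gpdP a)).

End GroupoidMap.

Lemma gpd_eq (E : digraph) (a b : gpd E) :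
  gsrc a = gsrc b -> gdeg a = gdeg b -> gtgt a = gtgt b -> a = b.
Proof.
case: a b => x k y P [x' k' y' P'] /= ex ek ey; subst x' k' y'.
by congr Gpd; exact: Prop_irrelevance.
Qed.

Section GroupoidIso.
Variables (E F : digraph) (h : bpath E -> bpath F) (g : bpath F -> bpath E).
Hypothesis hg : conjugacy h g.
Let gh : conjugacy g h := conjugacy_sym hg.

Lemma gpd_mapK : cancel (gpd_map hg) (gpd_map gh).
Proof. by have [_ _ hK _ _] := hg; move=> a; apply: gpd_eq; rewrite /= ?hK. Qed.

Lemma conjugacy_preimage_len m U : U `<=` blen_ge m -> h @^-1` U `<=` blen_ge m.
Proof.
have [_ _ hK _ _] := hg; move=> Um x /Um hx.
by have [] := conjugacy_iter gh hx; rewrite hK.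
Qed.

(** Half of the equality of shifted images required by [Zdata_conj]; [Zdata_sym] supplies the other
    half. *)
Lemma Zdata_image_sub U m n V : Zdata U m n V ->
  iter m (@shift E) @` (h @^-1` U) `<=` iter n (@shift E) @` (h @^-1` V).
Proof.
have [_ _ hK gK _] := hg.
move=> [[_ Um] [_ Vn] _ _ UV] _ [x Ux <-].
have [_ ex] := conjugacy_iter hg (conjugacy_preimage_len Um Ux).
have : (iter m (@shift F) @` U) (h (iter m (@shift E) x)) by exists (h x).
rewrite UV => -[v Vv ev]; exists (g v); first by rewrite /= gK.
by have [_ <-] := conjugacy_iter gh (Vn _ Vv); rewrite ev hK.
Qed.

Lemma Zdata_sym (G : digraph) (U V : set (bpath G)) m n : Zdata U m n V -> Zdata V n m U.
Proof. by move=> [oU oV iU iV UV]; split. Qed.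

Lemma Zdata_conj U m n V : Zdata U m n V -> Zdata (h @^-1` U) m n (h @^-1` V).
Proof.
move=> UV; have [hc _ hK _ _] := hg; have [[oU Um] [oV Vn] iU iV _] := UV.
have inj k W : W `<=` blen_ge k -> {in W &, injective (iter k (@shift F))} ->
    {in h @^-1` W &, injective (iter k (@shift E))}.
  move=> Wk iW x y; rewrite !inE => Wx Wy exy; apply: (can_inj hK); apply: iW; rewrite ?inE //.
  have [_ <-] := conjugacy_iter hg (conjugacy_preimage_len Wk Wx).
  by have [_ <-] := conjugacy_iter hg (conjugacy_preimage_len Wk Wy); rewrite exy.
split; try exact: inj.
- by split; [move/continuousP: hc; apply|exact: conjugacy_preimage_len].
- by split; [move/continuousP: hc; apply|exact: conjugacy_preimage_len].
by apply/seteqP; split; apply: Zdata_image_sub => //; exact: Zdata_sym.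
Qed.

Lemma gpd_map_preimage U m n V : Zdata U m n V ->
  gpd_map hg @^-1` (Zgpd U m n V) = Zgpd (h @^-1` U) m n (h @^-1` V).
Proof.
have [_ _ hK _ _] := hg.
move=> [[_ Um] [_ Vn] _ _ _]; apply/seteqP; split=> a [/= Ua Va aE e]; split=> //;
  have [_ ex] := conjugacy_iter hg (conjugacy_preimage_len Um Ua);
  have [_ ey] := conjugacy_iter hg (conjugacy_preimage_len Vn Va).
  by apply: (can_inj hK); rewrite ex ey.
by rewrite /= -ex -ey e.
Qed.

Lemma gpd_map_continuous : continuous (gpd_map hg).
Proof.
apply/continuousP => W [D DZ <-].
exists [set B | exists2 C, D C & B = gpd_map hg @^-1` C].
  move=> _ [C /DZ[U [m [n [V [UV ->]]]]] ->]; rewrite gpd_map_preimage //.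
  by exists (h @^-1` U), m, n, (h @^-1` V); split=> //; exact: Zdata_conj.
apply/seteqP; split=> a /=; first by move=> [_ [C DC ->] Ca]; exists C.
by move=> [C DC Ca]; exists (gpd_map hg @^-1` C) => //; exists C.
Qed.

End GroupoidIso.

Lemma conjugacy_gpd_isomorphic (E F : digraph) (h : bpath E -> bpath F) (g : bpath F -> bpath E) :
  conjugacy h g -> gpd_isomorphic E F.
Proof.
move=> hg; have gh := conjugacy_sym hg; have [_ _ hK gK _] := hg.
exists (gpd_map hg); split.
- split; first exact: gpd_map_continuous.
  exists (gpd_map (conjugacy_sym hg)); split; first exact: gpd_map_continuous.
    exact: gpd_mapK.
  by move=> a; apply: gpd_eq; rewrite /= ?gK.
- move=> a b; rewrite /composable /=; split=> [->//|]; exact: (can_inj hK).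
- by move=> a b c c'; apply: gpd_eq.
- by move=> a; apply: gpd_eq.
Qed.

Theorem theorem6p1 (R : realType) (E F : digraph) (hEF : conjugate E F) :
  gpd_isomorphic E F /\
  forall (A B : cstar_algebra R)
         (p : vert E -> A) (s : edge E -> A)
         (q : vert F -> B) (t : edge F -> B),
    is_graph_algebra p s -> is_graph_algebra q t ->
    exists Phi : A -> B,
      star_iso Phi /\ Phi @` graph_diagonal p s = graph_diagonal q t.
Proof.
have [h [g hg]] := conjugateP hEF; have gh := conjugacy_sym hg.
split; first exact: conjugacy_gpd_isomorphic hg.
move=> A B p s q t gp gq.
have [ckp _ univp] := gp; have [ckq _ univq] := gq.
have /choice[K KP] := edge_cover hg; have /choice[L LP] := edge_cover gh.
have uK e := (KP e).1; have {}KP e := (KP e).2.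
have uL f := (LP f).1; have {}LP f := (LP f).2.
have [Phi [PhiH Phi_p Phi_s]] := univp _ _ _ (transport_ck ckq hg uK KP).
have [Psi [PsiH Psi_p Psi_s]] := univq _ _ _ (transport_ck ckp gh uL LP).
have PhiK := PsiPhiK gp ckq hg uK KP uL LP PhiH PsiH Phi_p Phi_s Psi_p Psi_s.
have PsiK := PsiPhiK gq ckp gh uL LP uK KP PsiH PhiH Psi_p Psi_s Phi_p Phi_s.
exists Phi; split; first by split=> //; exists Psi.
apply/seteqP; split=> [_ [a aD <-]|b bD].
  exact: (Phi_diagonal gp ckq hg uK KP PhiH Phi_p Phi_s aD).
(* For surjectivity onto the diagonal, the inclusion is applied to [Psi], which comes from the
   inverse conjugacy. *)
exists (Psi b); last exact: PsiK.
exact: (Phi_diagonal gq ckp gh uL LP PsiH Psi_p Psi_s bD).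
Qed.
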